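(* Let $l\geq 3$ and let $a_1,a_2,\ldots,a_l\geq 1$ be integers. The triangulation polynomial of the weakly convex polygon $P(a_1,\ldots,a_l)$ is $$\sum_k\tau_k(a_1,\ldots,a_l)s^k=\Big\langle\prod_{i=1}^l\overline p_{a_i},\,t^2G_C(t)\Big\rangle_t .$$
   Context: A configuration is a finite subset $\mathcal C\subset\mathbb R^2$. A triangulation of $\mathcal C$ is a finite set of (non-degenerate) triangles with vertices in $\mathcal C$ whose union is $\mathrm{conv}(\mathcal C)$, any two intersecting in the empty set, a common vertex or a common edge; it uses the points of $\mathcal C$ that are vertices of its triangles. A weakly convex polygon is a configuration contained in the boundary of its convex hull; its edges are the segments joining consecutive extremal points (vertices of $\mathrm{conv}(\mathcal C)$), and an edge has weight $a$ if it contains exactly $a+1$ points of $\mathcal C$. $P(a_1,\ldots,a_l)$ is a weakly convex polygon with $l$ edges of successive weights $a_1,\ldots,a_l$ in counterclockwise order (determined up to isotopy, which preserves triangulation counts), and $\tau_k(a_1,\ldots,a_l)$ is the number of its triangulations using exactly $k$ points. The maximal edge polynomials are $p_m(t)=\sum_{k=0}^{\lfloor m/2\rfloor}(-1)^k\binom{m-k}{k}t^{m-k}$, and the complete edge polynomials are $\overline p_m=\sum_{k=1}^m\binom{m-1}{k-1}p_k(t)s^k\in\mathbb Z[s,t]$. $C_k=\binom{2k}{k}/(k+1)$ are the Catalan numbers, $G_C(t)=\sum_{k\ge0}C_kt^k$, and for $p=\sum_{k\geq 2}\alpha_k t^k$ with coefficients $\alpha_k\in\mathbb Z[s]$ one sets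 $\langle p,t^2G_C(t)\rangle_t=\sum_{k\geq2}\alpha_kC_{k-2}$. *)

(* Defs.v *)
From HB Require Import structures.
From mathcomp Require Import all_boot all_order all_algebra finmap.
From mathcomp Require Import all_classical all_reals all_analysis.

Set Implicit Arguments.
Unset Strict Implicit.
Unset Printing Implicit Defensive.

Import Order.TTheory GRing.Theory Num.Theory.
Import numFieldNormedType.Exports.

Local Open Scope classical_set_scope.
Local Open Scope ring_scope.

Section Configurations.
Variable R : realType.

Notation plane := 'rV[R]_2.

Definition config := {fset plane}.

Definition cross (u v : plane) : R := u 0 0 * v 0 1 - u 0 1 * v 0 0.

(* Positive iff p, q, r is a counterclockwise triple; zero iff p, q, r are
   collinear. *)
Definition orient (p q r : plane) : R := cross (q - p) (r - p).

Definition hull (A : {fset plane}) : set plane :=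
  [set x | exists w : plane -> R,
     [/\ forall p, p \in A -> 0 <= w p,
         \sum_(p <- A) w p = 1
       & x = \sum_(p <- A) w p *: p]].

Definition segment (p q : plane) : set plane := hull [fset p; q]%fset.

Definition boundary (A : set plane) : set plane := closure A `\` interior A.

Definition extreme_point (K : set plane) (p : plane) : Prop :=
  K p /\ forall (x y : plane) (t : R), K x -> K y -> 0 < t -> t < 1 ->
    p = t *: x + (1 - t) *: y -> x = y.

(* A non-degenerate triangle is encoded by the set t of its three vertices;
   the triangle itself is hull t. *)
Definition is_triangle (t : {fset plane}) : Prop :=
  exists p q r : plane, t = [fset p; q; r]%fset /\ orient p q r != 0.

Definition meet_properly (t u : {fset plane}) : Prop :=
  [\/ hull t `&` hull u = set0,
      exists p, [/\ p \in t, p \in u & hull t `&` hull u = [set p]]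
    | exists p q, [/\ p != q, p \in t /\ q \in t, p \in u /\ q \in u
                    & hull t `&` hull u = segment p q]].

Definition triangulation (C : config) (T : {fset {fset plane}}) : Prop :=
  [/\ forall t, t \in T -> is_triangle t /\ (t `<=` C)%fset,
      \bigcup_(t in [set` T]) hull t = hull C
    & forall t u, t \in T -> u \in T -> t != u -> meet_properly t u].

Definition used_points (T : {fset {fset plane}}) : {fset plane} :=
  (\bigcup_(t <- T) t)%fset.

Definition tau (C : config) (k : nat) : nat :=
  #|` [fset T in fpowerset (fpowerset C)
        | `[< triangulation C T >] && (#|` used_points T| == k)]%fset |.

Definition weakly_convex (C : config) : Prop :=
  [set` C] `<=` boundary (hull C).

(* v enumerates the extremal points in cyclic counterclockwise order: every
   other extremal point lies strictly to the left of the oriented line from v i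
   to its cyclic successor v (ordS i). *)
Definition ccw_vertices (C : config) (l : nat) (v : 'I_l -> plane) : Prop :=
  [/\ injective v,
      range v = extreme_point (hull C)
    & forall i j, j != i -> j != ordS i -> 0 < orient (v i) (v (ordS i)) (v j)].

Definition edge_weight (C : config) (p q : plane) (a : nat) : Prop :=
  #|` [fset x in C | `[< segment p q x >]]%fset | = a.+1.

Definition is_P (l : nat) (a : 'I_l -> nat) (C : config) : Prop :=
  weakly_convex C /\
  exists v : 'I_l -> plane, ccw_vertices C v /\
    forall i, edge_weight C (v i) (v (ordS i)) (a i).

(* No triangulation uses more than #|` C| points, so this is the full
   generating polynomial of (tau C k)_k. *)
Definition triangulation_poly (C : config) : {poly int} :=
  \sum_(k < (#|` C|).+1) (tau C k)%:R *: 'X^k.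

End Configurations.

Definition max_edge_poly (m : nat) : {poly int} :=
  \sum_(k < (m./2).+1) ((-1) ^+ k * ('C(m - k, k))%:R) *: 'X^(m - k).

(* Z[s,t] is represented as Z[s][t]: the outer variable is t, and s is the
   constant 'X%:P. *)
Definition complete_edge_poly (m : nat) : {poly {poly int}} :=
  \sum_(1 <= k < m.+1)
    ((max_edge_poly k)^:P * ('X%:P) ^+ k) *+ 'C(m - 1, k - 1).

(* The division is exact. *)
Definition catalan (k : nat) : nat := 'C(2 * k, k) %/ k.+1.

(* Meant for p with no term of degree < 2 in t. *)
Definition catalan_pairing (p : {poly {poly int}}) : {poly int} :=
  \sum_(2 <= k < size p) p`_k * (catalan (k - 2))%:R.

(* Main.v *)
(* Number the N points x_0, ..., x_(N-1) of the polygon counterclockwise from a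
   corner.  Every triangulation has exactly one triangle x_0 x_k x_q resting on
   the last side at x_0, and removing it leaves triangulations of the chains
   x_0 ... x_k and x_k ... x_q, where a chain contained in a side has only the
   empty triangulation.  So the generating functions H i j of the chains satisfy
   H i j = s on the sides and H i j = \sum_(i < k < j) H i k * H k j elsewhere.
   Put W i j = s - (j - i - 1) s^2 on the sides and 0 elsewhere: then
   H = W + H^2, except for the chains that wrap around x_0, hence
   H = \sum_k C_k W^(k+1) by the Catalan recurrence.  On the other hand the edge
   polynomial of weight m is the sum of t^k w_(m_1) ... w_(m_k) over the
   compositions m_1 + ... + m_k = m, where w_d = s - (d - 1) s^2, so that the
   product of the edge polynomials is \sum_k t^k (W^k)_(0, N). *)
Require Import Defs.
From mathcomp Require Import all_boot all_order all_algebra finmap.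
From mathcomp Require Import all_classical all_reals all_analysis.
From mathcomp Require Import zify ring lra.

Set Implicit Arguments.
Unset Strict Implicit.
Unset Printing Implicit Defensive.

Import Order.TTheory GRing.Theory Num.Theory.
Import numFieldNormedType.Exports.

Local Open Scope ring_scope.

(** * Catalan numbers and edge polynomials *)

(** The obstacle is the last side. A triangulation may skip boundary points, so x_q ranges over all
    of x_A, ..., x_(N-1), and the chains x_0 ... x_q with q > A, being collinear with x_0 at their
    end, escape the plain recurrence. Doubling x_0 as the index N makes W strictly triangular, and
    the entries W q N turn out to be exactly the correction for those chains. The value s - (d - 1)
    s^2 has one origin: on a side H = s, whereas H^2 contributes d - 1 products s^2. Exponents in H
    count the used points minus one, so that they add up when two chains are glued at a point. On
    the geometric side, a triangulation is given by covering and pairwise intersections, so that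
    removing a triangle leaves two triangulations has to be derived: no other triangle crosses the
    removed one, and each part still covers its chain because finite unions of triangles are closed.
    These arguments rest on the signs of orientations of increasing triples of indices, which are
    nonnegative and vanish exactly on a common side; the polygon enters through [S] and [A]
    alone. *)

Lemma catalanM n : (catalan n * n.+1 = 'C(2 * n, n))%N.
Proof.
rewrite /catalan divnK//.
have h := mul_bin_diag (2 * n) n; have h2 := mul_bin_left (2 * n) n.
(* Hence n + 1 divides n C(2n, n), and it is coprime to n. *)
have e : ('C(2 * n, n.+1) * n.+1 = n * 'C(2 * n, n))%N.
  by rewrite mulnC h2; congr (_ * _)%N; lia.
have d : (n.+1 %| n * 'C(2 * n, n))%N by rewrite -e dvdn_mull.
by rewrite Gauss_dvdr// coprimeSn in d.
Qed.

Lemma catalanS n : (n.+2 * catalan n.+1 = (4 * n + 2) * catalan n)%N.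
Proof.
have e0 := catalanM n; have e1 := catalanM n.+1.
have h1 : (n.+1 * 'C(2 * n.+1, n.+1) = 2 * n.+1 * 'C((2 * n).+1, n))%N.
  by rewrite -mul_bin_diag; congr (_ * 'C(_, _))%N; lia.
have h2 : (n.+1 * 'C((2 * n).+1, n) = (2 * n).+1 * 'C(2 * n, n))%N.
  have -> : 'C((2 * n).+1, n) = 'C((2 * n).+1, n.+1).
    by rewrite -bin_sub; [congr ('C(_, _)); lia|lia].
  by rewrite -mul_bin_diag.
apply/eqP; rewrite -(eqn_pmul2l (ltn0Sn n)) -(eqn_pmul2l (ltn0Sn n)).
apply/eqP; transitivity (n.+1 * (2 * (n.+1 * 'C((2 * n).+1, n))))%N.
  by congr (_ * _)%N; rewrite [(n.+2 * _)%N]mulnC e1 h1; lia.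
rewrite h2 -e0; lia.
Qed.

Lemma catalan0 : catalan 0 = 1%N. Proof. by []. Qed.

(* Weighting the convolution by i + 1 multiplies it by (n + 2) / 2, by symmetry,
   and [catalanS] then yields a first-order recurrence. *)
Lemma catalan_convolution n :
  (\sum_(i < n.+1) catalan i * catalan (n - i) = catalan n.+1)%N.
Proof.
pose s n := (\sum_(i < n.+1) catalan i * catalan (n - i))%N.
pose t n := (\sum_(i < n.+1) i.+1 * (catalan i * catalan (n - i)))%N.
have st m : (2 * t m = m.+2 * s m)%N.
  have e : t m = (\sum_(i < m.+1) (m - i).+1 * (catalan i * catalan (m - i)))%N.
    rewrite /t (reindex_inj rev_ord_inj) /=; apply: eq_bigr => i _.
    by rewrite subSS subKn ?[(catalan (m - i) * _)%N]mulnC// -ltnS.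
  rewrite mul2n -addnn {2}e /t -big_split /s big_distrr /=; apply: eq_bigr => i _.
  have := ltn_ord i; rewrite ltnS => hi.
  by rewrite -mulnDl; congr (_ * _)%N; lia.
(* By [catalanS], (i + 2) C_(i+1) = 4 (i + 1) C_i - 2 C_i; the isolated C_(m+1) is the term i =
   0. *)
have ts m : (t m.+1 + 2 * s m = catalan m.+1 + 4 * t m)%N.
  rewrite /t big_ord_recl /= catalan0 !mul1n subn0 -addnA; congr (_ + _)%N.
  rewrite /s !big_distrr -big_split /=; apply: eq_bigr => i _.
  rewrite /bump /= add1n subSS.
  have := catalanS i; move: (catalan i.+1) (catalan i) (catalan (m - i)) => a b c h.
  by rewrite mulnA h; lia.
rewrite -/(s n); elim: n => [|m IH]; first by rewrite /s big_ord1.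
have h1 := st m.+1; have h2 := ts m; have h3 := st m; have h4 := catalanS m.+1.
rewrite IH in h2 h3.
apply/eqP; rewrite -(eqn_pmul2l (ltn0Sn m.+2)); apply/eqP.
rewrite h4 -h1; lia.
Qed.

(** The added binomials vanish, since k > m - k. Summing up to m keeps the parity of m out of the
    recurrence. *)
Lemma max_edge_polyE m :
  max_edge_poly m = \sum_(k < m.+1) ((-1) ^+ k * ('C(m - k, k))%:R) *: 'X^(m - k).
Proof.
rewrite /max_edge_poly [RHS](bigID (fun k : 'I_m.+1 => (k < (m./2).+1)%N)) /=.
rewrite [X in _ + X]big1 ?addr0; last first.
  by move=> k hk; rewrite bin_small ?mulr0 ?scale0r//; lia.
by rewrite (big_ord_widen m.+1 (fun k => ((-1) ^+ k * ('C(m - k, k))%:R) *: 'X^(m - k)))//; lia.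
Qed.

Lemma max_edge_poly0 : max_edge_poly 0 = 1.
Proof. by rewrite /max_edge_poly big_ord1 bin0 expr0 mul1r scale1r. Qed.

Lemma max_edge_poly1 : max_edge_poly 1 = 'X.
Proof. by rewrite /max_edge_poly big_ord1 bin0 expr0 mul1r scale1r. Qed.

(** Pascal's rule, term by term. It is the Chebyshev recurrence: p_m(t) = t^(m/2) U_m(sqrt t / 2),
    with U_m of the second kind. *)
Lemma max_edge_poly_rec m :
  max_edge_poly m.+2 = 'X * max_edge_poly m.+1 - 'X * max_edge_poly m.
Proof.
pose F m k : {poly int} := ((-1) ^+ k * ('C(m - k, k))%:R) *: 'X^(m - k).
have E n : max_edge_poly n = \sum_(k < n.+1) F n k by rewrite max_edge_polyE.
have F0 n : F n.+1 0 = 'X * F n 0.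
  by rewrite /F !bin0 !subn0 expr0 mul1r !scale1r exprS.
have FS n k : (k <= n)%N -> F n.+2 k.+1 = 'X * F n.+1 k.+1 - 'X * F n k.
  move=> kn; rewrite /F !subSS subSn// binS natrD mulrDr scalerDl.
  rewrite -!scalerAr -!exprS -scaleNr; congr (_ *: _ + _ *: _).
  by rewrite exprS; ring.
rewrite !E big_ord_recr /= [F m.+2 m.+2]/F bin_small ?mulr0 ?scale0r ?addr0; last lia.
rewrite big_ord_recl [in RHS]big_ord_recl /= F0 mulrDr -addrA; congr (_ + _).
rewrite !mulr_sumr -sumrB; apply: eq_bigr => i _; rewrite /bump /= add1n FS//.
by rewrite -ltnS.
Qed.

(** * Edge polynomials as sums over compositions *)

Section EdgeWeights.

Notation s := (('X : {poly int})%:P).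

(* The edge polynomials have generating function t w / (1 - t w) for
   w = s z (1 - z - s z) / (1 - z)^2, and [step_weight d] is the coefficient of
   z^d in w, with s = 'X. *)
Definition step_weight (d : nat) : {poly int} := 'X - 'X ^+ 2 *+ d.-1.

(** The value 1 at 0 stands for the empty composition; [complete_edge_poly 0] is an empty sum. *)
Definition edge_poly (d : nat) : {poly {poly int}} :=
  if d is 0 then 1 else complete_edge_poly d.

Local Arguments edge_poly : simpl never.

Lemma binomial_sumS (V : zmodType) (F : nat -> V) b :
  \sum_(k < b.+2) F k *+ 'C(b.+1, k) =
  \sum_(k < b.+1) F k *+ 'C(b, k) + \sum_(k < b.+1) F k.+1 *+ 'C(b, k).
Proof.
rewrite big_ord_recl bin0 [in RHS]big_ord_recl bin0 -addrA; congr (_ + _).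
rewrite (eq_bigr (fun i : 'I_b.+1 => F i.+1 *+ 'C(b, i.+1) + F i.+1 *+ 'C(b, i))).
  by rewrite big_split /= big_ord_recr /= bin_small// mulr0n addr0.
by move=> i _; rewrite /= /bump /= add1n binS mulrnDr.
Qed.

(** Both sides obey the same difference equation. On the left, Pascal's rule and the recurrence of
    p_k give X_(c+1) = X_c + t s X_c - t s^2 Y_c, where X_c is the edge polynomial of weight c + 1
    and Y_c is the sum of those of weight at most c. On the right, raising d by one adds the step of
    weight w_1 = s and lowers every other w by s^2. *)
Lemma edge_poly_rec d : (0 < d)%N ->
  edge_poly d = \sum_(c < d) 'X * (step_weight (d - c))%:P * edge_poly c.
Proof.
case: d => // b _.
pose P k : {poly {poly int}} := (max_edge_poly k)^:P.
have PS k : P k.+2 = 'X * P k.+1 - 'X * P k.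
  by rewrite /P max_edge_poly_rec rmorphB !rmorphM /= map_polyX.
pose F k := P k * s ^+ k.
have FS k : F k.+2 = 'X * s * F k.+1 - 'X * s ^+ 2 * F k.
  by rewrite /F PS !exprS; ring.
pose X b := \sum_(k < b.+1) F k.+1 *+ 'C(b, k).
pose Y b := \sum_(k < b.+1) F k *+ 'C(b, k).
have eX c : edge_poly c.+1 = X c.
  rewrite /edge_poly /complete_edge_poly /X big_add1 /= big_mkord.
  by apply: eq_bigr => k _; rewrite !subn1 /=.
have YS c : Y c.+1 = Y c + X c by rewrite /Y binomial_sumS.
have XS c : X c.+1 = X c + ('X * s * X c - 'X * s ^+ 2 * Y c).
  rewrite {1}/X (binomial_sumS (fun k => F k.+1)); congr (_ + _).
  rewrite /X /Y !mulr_sumr -sumrB; apply: eq_bigr => k _.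
  by rewrite FS mulrnBl !mulrnAr.
have Y0 : Y 0 = 1 by rewrite /Y big_ord1 /F /P max_edge_poly0 rmorph1 mulr1.
have X0 : X 0 = 'X * s.
  by rewrite /X big_ord1 /F /P max_edge_poly1 map_polyX expr1.
have YE c : Y c = \sum_(k < c.+1) edge_poly k.
  elim: c => [|c IH]; first by rewrite big_ord1.
  by rewrite YS IH [RHS]big_ord_recr /= -eX.
elim: b => [|b IH].
  by rewrite big_ord1 eX X0 /step_weight /= mulr0n subr0 mulr1.
rewrite eX XS -eX YE [in RHS]big_ord_recr /= subSnn /step_weight /= mulr0n subr0.
rewrite [LHS]addrCA [RHS]addrC; congr (_ + _); rewrite {1}IH mulr_sumr -sumrB.
apply: eq_bigr => c _; have hc := ltn_ord c.
have -> : (b.+2 - c = (b.+1 - c).+1)%N by lia.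
rewrite /step_weight /= (_ : (b.+1 - c = (b.+1 - c).-1.+1)%N) /=; last by lia.
move: (_.-1) => d; rewrite mulrS !polyCB polyCD !polyCMn !polyC_exp; ring.
Qed.
End EdgeWeights.

Lemma sum_ord_interval (V : nmodType) (f : nat -> V) m n N : (n <= N)%N ->
  (forall k, (k < N)%N -> ~~ (m <= k < n)%N -> f k = 0) ->
  \sum_(k < N) f k = \sum_(m <= k < n) f k.
Proof.
move=> nN f0; rewrite big_geq_mkord (big_ord_widen_cond _ _ _ nN).
rewrite (bigID (fun k : 'I_N => (m <= k)%N && (k < n)%N)) /= [X in _ + X]big1 ?addr0//.
by move=> k; apply: f0.
Qed.

(** * The Catalan series of a nilpotent matrix *)

Section NilpotentCatalan.
Variables (K : comNzRingType) (N : nat) (W : 'M[K]_N.+1).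
Hypothesis W_upper : forall a b : 'I_N.+1, (b <= a)%N -> W a b = 0.

Lemma upper_exp k (a b : 'I_N.+1) : (b < a + k)%N -> (W ^+ k) a b = 0.
Proof.
elim: k a b => [|k IH] a b h.
  rewrite expr0 mxE; case: eqP => // e; move: h; rewrite e; lia.
rewrite exprSr -[_ * _]/(_ *m _) mxE big1// => c _.
have [ca|ac] := ltnP c (a + k); first by rewrite IH ?mul0r.
by rewrite W_upper ?mulr0//; lia.
Qed.

Lemma upper_exp0 k : (N < k)%N -> W ^+ k = 0.
Proof.
move=> hk; apply/matrixP => a b; rewrite upper_exp ?mxE//.
by have := ltn_ord b; lia.
Qed.

(** The whole series \sum_k C_k W^(k+1): the omitted powers exceed N and vanish. *)
Definition catalan_mx : 'M[K]_N.+1 := \sum_(k < N) W ^+ k.+1 *+ catalan k.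

Lemma catalan_mxM : catalan_mx * W = \sum_(k < N) W ^+ k.+2 *+ catalan k.
Proof.
by rewrite /catalan_mx mulr_suml; apply: eq_bigr => k _; rewrite mulrnAl -exprSr.
Qed.

Lemma catalan_mx_rec : (0 < N)%N -> catalan_mx = W + catalan_mx * catalan_mx.
Proof.
move=> N0.
have -> : catalan_mx * catalan_mx = \sum_(s < N) W ^+ s.+2 *+ catalan s.+1.
  rewrite {1}/catalan_mx mulr_suml.
  (* Reindexing by s = i + j; the pairs with i + j >= N carry a power of W above N, which is 0. *)
  transitivity (\sum_(i < N) \sum_(s < N | (i <= s)%N)
      W ^+ s.+2 *+ (catalan i * catalan (s - i))).
    apply: eq_bigr => i _; rewrite /catalan_mx mulr_sumr.
    transitivity (\sum_(j < N | (i + j < N)%N) W ^+ (i + j).+2 *+ (catalan i * catalan j)).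
      rewrite [LHS](bigID (fun j : 'I_N => (i + j < N)%N)) /= [X in _ + X]big1 ?addr0.
        apply: eq_bigr => j _; rewrite mulrnAl mulrnAr -mulrnA -exprD mulnC.
        by congr (W ^+ _ *+ _); lia.
      move=> j hj; rewrite mulrnAl mulrnAr -exprD upper_exp0 ?mul0rn//.
      by lia.
    rewrite -(big_mkord (fun j => (i + j < N)%N)
      (fun j => W ^+ (i + j).+2 *+ (catalan i * catalan j))).
    rewrite -(big_mkord (fun s => (i <= s)%N)
      (fun s => W ^+ s.+2 *+ (catalan i * catalan (s - i)))).
    have hi := ltn_ord i.
    rewrite [RHS](@big_cat_nat _ _ _ i) //=; last exact: ltnW.
    rewrite [X in _ = X + _]big_nat_cond [X in _ = X + _]big_pred0 ?add0r; last by move=> k /=; lia.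
    have := @big_addn _ 0 +%R 0 N i (fun s => (i <= s)%N)
      (fun s => W ^+ s.+2 *+ (catalan i * catalan (s - i))).
    rewrite add0n => ->; rewrite [LHS](@big_cat_nat _ _ _ (N - i)) //=; last by lia.
    rewrite [X in _ + X]big_nat_cond [X in _ + X]big_pred0 ?addr0; last by move=> k /=; lia.
    rewrite big_nat_cond [RHS]big_nat_cond; apply: eq_big => [j|j _]; first by lia.
    by rewrite addnK addnC.
  rewrite (exchange_big_dep xpredT) //=; apply: eq_bigr => s _.
  rewrite -catalan_convolution (big_ord_widen N (fun i => catalan i * catalan (s - i))%N)//.
  by rewrite -sumrMnr; apply: eq_bigl => i; rewrite ltnS.
(* The two sums match up to the last term of the square, which contains W^(N+1) = 0. *)
rewrite /catalan_mx; case: N N0 W W_upper upper_exp0 => // n _ W' _ W0.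
rewrite big_ord_recl expr1 mulr1n; congr (_ + _).
by rewrite [RHS]big_ord_recr /= W0// mul0rn addr0.
Qed.

End NilpotentCatalan.

(** * Weighted paths along the sides *)

Section StepMatrix.
Variables (N : nat) (S : nat -> nat -> bool).

Definition step (a b : nat) : {poly int} :=
  if (a < b)%N && S a b then step_weight (b - a) else 0.

Definition step_mx : 'M[{poly int}]_N.+1 := \matrix_(a, b) step a b.

(** Sum over the paths from a to b whose steps stay inside sides, with an extra factor C_k for a
    path of k + 1 steps. Indices are natural numbers for convenience and are meaningful up to N. *)
Definition paths (a b : nat) : {poly int} := catalan_mx step_mx (inord a) (inord b).

Lemma step_mx_upper (a b : 'I_N.+1) : (b <= a)%N -> step_mx a b = 0.
Proof. by rewrite mxE /step ltnNge => ->. Qed.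

Lemma paths0 a b : (b <= a <= N)%N -> paths a b = 0.
Proof.
move=> ab; rewrite /paths /catalan_mx summxE big1// => k _.
by rewrite mulmxnE upper_exp ?mul0rn//; [exact: step_mx_upper|rewrite !inordK; lia].
Qed.

(** The entry (a, b) of M = W + M^2, where strict triangularity leaves the indices a < k < b. *)
Lemma paths_rec a b : (a < b <= N)%N ->
  paths a b = step a b + \sum_(a.+1 <= k < b) paths a k * paths k b.
Proof.
move=> ab; have N0 : (0 < N)%N by lia.
rewrite /paths {1}(catalan_mx_rec step_mx_upper N0) 2!mxE !inordK; [|lia..].
congr (_ + _); transitivity (\sum_(k < N.+1) paths a k * paths k b).
  by rewrite -[_ * _]/(_ *m _) mxE; apply: eq_bigr => k _; rewrite /paths !inord_val.
rewrite (sum_ord_interval (f := fun k => paths a k * paths k b) (m := a.+1) (n := b)) //; first lia.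
move=> k kN hk; have [ka|ak] := leqP k a; first by rewrite paths0 ?mul0r//; lia.
by rewrite [paths k b]paths0 ?mulr0//; lia.
Qed.

(** The variable t marks the number of steps of the paths from 0 to j. *)
Definition path_poly (j : nat) : {poly {poly int}} :=
  \poly_(k < N.+1) (step_mx ^+ k) ord0 (inord j).

Lemma path_poly0 : path_poly 0 = 1.
Proof.
apply/polyP => k; rewrite coef_poly coef1; case: k => [|k] /=.
  by rewrite expr0 mxE -val_eqE /= inordK.
case: ltnP => // h; rewrite upper_exp//; first exact: step_mx_upper.
by rewrite inordK.
Qed.

(** Decomposition of a path according to its last step, from c to j. *)
Lemma path_poly_rec j : (0 < j <= N)%N ->
  path_poly j = \sum_(c < j) 'X * (step c j)%:P * path_poly c.
Proof.
move=> hj; apply/polyP => k; rewrite coef_sum.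
under eq_bigr do rewrite -mulrA coefXM coefCM.
case: k => [|k] /=; rewrite coef_poly.
  rewrite /= expr0 mxE -val_eqE /= inordK; last lia.
  rewrite big1//; case: j hj => //.
transitivity ((step_mx ^+ k.+1) ord0 (inord j)).
  case: ltnP => // h; rewrite upper_exp0//; first by rewrite mxE.
  exact: step_mx_upper.
rewrite exprSr -[_ * _]/(_ *m _) mxE.
transitivity (\sum_(c < N.+1) (step_mx ^+ k) ord0 (inord c) * step c j).
  apply: eq_bigr => c _; rewrite inord_val; congr (_ * _).
  by rewrite mxE inordK//; lia.
rewrite (sum_ord_interval (f := fun c => (step_mx ^+ k) ord0 (inord c) * step c j)
  (m := 0) (n := j)).
- rewrite big_mkord; apply: eq_bigr => c _; rewrite coef_poly mulrC; congr (_ * _).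
  case: ltnP => // h; rewrite upper_exp0//; first by rewrite mxE.
  exact: step_mx_upper.
- lia.
- move=> c cN hc; rewrite /step; case: ifP => [/andP[cj _]|_]; last by rewrite mulr0.
  by move: hc; rewrite cj.
Qed.

(** The pairing replaces t^k by C_(k-2), which turns \sum_k t^k W^k into \sum_k C_k W^(k+2), that
    is, into M W. *)
Lemma pairing_path_poly : (0 < N)%N -> catalan_pairing (path_poly N) =
  \sum_(q < N) paths 0 q * step q N.
Proof.
move=> N0; transitivity ((catalan_mx step_mx * step_mx) ord0 (inord N)); last first.
  rewrite -[_ * _]/(_ *m _) mxE big_ord_recr /= step_mx_upper ?inordK//.
  rewrite mulr0 addr0; apply: eq_bigr => q _; rewrite /paths mxE /= inordK// .
  have -> : inord 0 = ord0 :> 'I_N.+1 by apply: val_inj; rewrite /= inordK.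
  congr (catalan_mx _ _ _ * _); apply: val_inj; rewrite /= inordK//.
  by have := ltn_ord q; lia.
rewrite catalan_mxM summxE /catalan_pairing.
have sz : (size (path_poly N) <= N.+1)%N by exact: size_poly.
transitivity (\sum_(2 <= k < N.+2) (step_mx ^+ k) ord0 (inord N) *+ catalan (k - 2)).
  rewrite (big_nat_widen _ _ N.+2) /=; last exact: leqW.
  rewrite big_mkcond /= big_nat [RHS]big_nat; apply: eq_bigr => k hk.
  have e : (path_poly N)`_k = (step_mx ^+ k) ord0 (inord N).
    rewrite coef_poly; case: ltnP => // h; rewrite upper_exp0//; first by rewrite mxE.
    exact: step_mx_upper.
  case: ltnP => h; first by rewrite e mulr_natr.
  by rewrite -e nth_default ?mul0rn.
rewrite 2!big_add1 /= big_mkord; apply: eq_bigr => k _.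
by rewrite mulmxnE !subSS subn0.
Qed.

End StepMatrix.

(* Here [S i j] says that the points x_i and x_j lie on a common side, the index N
   stands for x_0 again, and A is the first index of the last side. *)
Section ChainAlgebra.
Variables (N A : nat) (S : nat -> nat -> bool) (H : nat -> nat -> {poly int}).
Hypothesis S_sub : forall a b c d, (a <= b)%N -> (c <= d)%N -> S a d -> S b c.
Hypothesis AN : (0 < A < N)%N.
Hypothesis S_last : forall q, (q < N)%N -> S q N = (A <= q)%N.
Hypothesis S_first : ~~ S 0 A.
Hypothesis H_S : forall i j, (i < j < N)%N -> S i j -> H i j = 'X.
Hypothesis H_nS : forall i j, (i < j < N)%N -> (0 < i)%N || (j <= A)%N -> ~~ S i j ->
  H i j = \sum_(i.+1 <= k < j) H i k * H k j.

Local Notation M := (paths N S).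
Local Notation w := (step S).

(** Strong induction on j - i. When x_i and x_j lie on a side, each of the j - i - 1 intermediate
    points contributes s^2 to the recurrence of M, which is precisely what [step_weight]
    subtracts. *)
Lemma chain_poly_paths i j : (i < j < N)%N -> (0 < i)%N || (j <= A)%N -> H i j = M i j.
Proof.
have [n le_n] := ubnP (j - i); elim: n => // n IH in i j le_n *.
move=> ij hA; rewrite paths_rec; last lia.
have IHl k : (i < k < j)%N -> M i k = H i k by move=> hk; rewrite IH//; lia.
have IHr k : (i < k < j)%N -> M k j = H k j by move=> hk; rewrite IH//; lia.
rewrite (eq_big_nat _ _ (F2 := fun k => H i k * H k j)); last first.
  by move=> k hk; rewrite IHl ?IHr.
have [Sij|nS] := boolP (S i j); last by rewrite /step (negPf nS) andbF add0r -H_nS.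
rewrite (eq_big_nat _ _ (F2 := fun=> 'X ^+ 2)); last first.
  by move=> k hk; rewrite !H_S ?expr2//; try lia; apply: S_sub Sij; lia.
rewrite H_S // sumr_const_nat /step Sij /= (_ : (i < j)%N) /=; last lia.
rewrite /step_weight (_ : (j - i).-1 = (j - i.+1)%N); last lia.
by rewrite subrK.
Qed.

(** For q >= A, the recurrence of M 0 q has no direct step; its terms with k < A are those of the
    left-hand side, and its terms with k >= A are s M 0 k, as x_k and x_q lie on the last side. The
    inner sum is thus M 0 q - s \sum_(A <= k < q) M 0 k. After multiplication by s and summation
    over q, each M 0 k has the coefficient s - (N - k - 1) s^2, because N - k - 1 values of q lie
    beyond k: this is the weight of the step from k to N. *)
Lemma chain_poly_total :
  'X * \sum_(1 <= k < A) \sum_(A <= q < N) H 0 k * H k q = \sum_(q < N) M 0 q * w q N.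
Proof.
rewrite exchange_big /=.
have step1 q : (A <= q < N)%N -> \sum_(1 <= k < A) H 0 k * H k q =
    M 0 q - \sum_(A <= k < q) M 0 k * 'X.
  move=> hq; rewrite paths_rec; last lia.
  have -> : w 0 q = 0.
    rewrite /step; case: ifP => // /andP[_ S0q]; move: S_first.
    by rewrite (S_sub _ _ S0q)//; lia.
  rewrite add0r [in RHS](@big_cat_nat _ _ _ A) //=; [|lia..].
  have -> : \sum_(A <= k < q) M 0 k * M k q = \sum_(A <= k < q) M 0 k * 'X.
    apply: eq_big_nat.
    move=> k hk; rewrite -[M k q]chain_poly_paths; [|lia..].
    rewrite H_S//; first lia.
    by apply: (@S_sub k k q N); rewrite ?S_last; lia.
  rewrite addrK; apply: eq_big_nat => k hk; rewrite !chain_poly_paths//; lia.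
rewrite (eq_big_nat _ _ step1) sumrB mulrBr.
rewrite (sum_ord_interval (f := fun q => M 0 q * w q N) (m := A) (n := N))//; last first.
  move=> q qN hq; rewrite /step S_last// (_ : (A <= q)%N = false) ?andbF ?mulr0//; lia.
rewrite [RHS](eq_big_nat _ _
  (F2 := fun q => 'X * M 0 q - 'X ^+ 2 * M 0 q *+ (N - q).-1)); last first.
  move=> q hq; rewrite /step S_last (_ : (q < N)%N) /=; [|lia..].
  by rewrite (_ : (A <= q)%N) /step_weight; [ring|lia].
rewrite [RHS]sumrB -mulr_sumr; congr (_ - _).
rewrite (eq_big_nat _ _ (F2 := fun q => \sum_(A <= k < N | (k < q)%N) M 0 k * 'X)); last first.
  by move=> q hq; rewrite (big_nat_widen _ _ N) //=; lia.
rewrite (exchange_big_dep_nat xpredT) //= mulr_sumr; apply: eq_big_nat => k hk.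
rewrite big_const_seq iter_addr_0 mulrnAr; congr (_ *+ _); first by ring.
transitivity (count (fun q => (k.+1 <= q)%N) (index_iota A N)).
  by apply: eq_count => q; rewrite /= .
transitivity (size (index_iota k.+1 N)); last by rewrite size_iota; lia.
rewrite -size_filter; congr size; apply: (irr_sorted_eq ltn_trans ltnn).
- by apply: sorted_filter; [exact: ltn_trans|exact: iota_ltn_sorted].
- exact: iota_ltn_sorted.
- by move=> q; rewrite mem_filter !mem_index_iota; lia.
Qed.

End ChainAlgebra.

(** * Sides as intervals of indices, and factorization at the corners *)

Section Sides.
Variables (l : nat) (a : nat -> nat).

(** The index of the r-th vertex; [corner l] is the number of points, that is, the second index of
    x_0. *)
Definition corner (r : nat) : nat := \sum_(i < r) a i.

Definition same_side (c d : nat) : bool :=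
  [exists r : 'I_l, (corner r <= c)%N && (d <= corner r.+1)%N].

Lemma cornerS r : corner r.+1 = (corner r + a r)%N.
Proof. by rewrite /corner big_ord_recr. Qed.

Lemma corner_mono r r' : (r <= r')%N -> (corner r <= corner r')%N.
Proof.
move=> h; rewrite /corner (big_ord_widen r' a h).
by rewrite [leqRHS](bigID (fun i : 'I_r' => (i < r)%N)) leq_addr.
Qed.

Lemma same_sideP c d : reflect (exists2 r, (r < l)%N & (corner r <= c)%N && (d <= corner r.+1)%N)
  (same_side c d).
Proof.
apply: (iffP existsP) => [[r h]|[r rl h]]; first by exists r.
by exists (Ordinal rl).
Qed.

(** No step jumps over a corner, so every path visits all of them and the sum factors. Beyond
    [corner r], the paths along one side satisfy the recurrence [edge_poly_rec]. *)
Lemma path_poly_corner r : (r <= l)%N ->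
  path_poly (corner l) same_side (corner r) = \prod_(i < r) edge_poly (a i).
Proof.
elim: r => [|r IH] rl; first by rewrite /corner !big_ord0 path_poly0.
rewrite big_ord_recr /= -IH ?(ltnW rl)// cornerS.
suff {IH} H d : (d <= a r)%N -> path_poly (corner l) same_side (corner r + d) =
    path_poly (corner l) same_side (corner r) * edge_poly d by exact: H.
have [n le_n] := ubnP d; elim: n => // n IH in d le_n *.
case: d le_n => [|d] le_n dr; first by rewrite addn0 /edge_poly mulr1.
have hr : (corner r + d.+1 <= corner l)%N.
  have h1 := corner_mono rl; rewrite cornerS in h1; lia.
rewrite path_poly_rec; last lia.
rewrite edge_poly_rec// mulr_sumr.
rewrite (sum_ord_interval (f := fun c => 'X * (step same_side c (corner r + d.+1))%:P *
  path_poly (corner l) same_side c) (m := corner r) (n := corner r + d.+1))//; last first.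
  move=> c hc1 hc2; rewrite /step; case: ifP => [/andP[_ /same_sideP[r' r'l h]]|_].
    have [rr'|r'r] := leqP r r'; first by have := corner_mono rr'; lia.
    by have := corner_mono r'r; lia.
  by rewrite polyC0 mulr0 mul0r.
rewrite -{1}[corner r]add0n big_addn addKn big_mkord; apply: eq_bigr => c _.
have hc := ltn_ord c; rewrite addnC IH; [|lia..].
rewrite /step (_ : same_side _ _); last first.
  by apply/same_sideP; exists r => //; rewrite cornerS; lia.
rewrite (_ : (_ < _)%N) /=; last by lia.
by rewrite subnDl; ring.
Qed.

End Sides.

(** * Convex hulls and triangles in the plane *)

Local Open Scope classical_set_scope.

Section Orientation.
Variable R : realType.
Notation plane := 'rV[R]_2.
Implicit Types (p q r x y z : plane) (A B : {fset plane}).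

Lemma orientE p q r : orient p q r =
  (q 0 0 - p 0 0) * (r 0 1 - p 0 1) - (q 0 1 - p 0 1) * (r 0 0 - p 0 0).
Proof. by rewrite /orient /cross !mxE. Qed.

Lemma orient_rot p q r : orient p q r = orient q r p.
Proof. by rewrite !orientE; ring. Qed.

Lemma orient_swap p q r : orient p q r = - orient p r q.
Proof. by rewrite !orientE; ring. Qed.

Lemma orient_flip p q r : orient p q r = - orient q p r.
Proof. by rewrite !orientE; ring. Qed.

Lemma orient_idl p q : orient p p q = 0.
Proof. by rewrite orientE; ring. Qed.

Lemma orient_idr p q : orient p q q = 0.
Proof. by rewrite orientE; ring. Qed.

Lemma orient_ids p q : orient p q p = 0.
Proof. by rewrite orientE; ring. Qed.

(** The Grassmann-Plucker relation for four vectors issued from o; it transfers signs between turns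
    around a common point. *)
Lemma orient_plucker o p q r s :
  orient o p q * orient o r s - orient o p r * orient o q s
  + orient o p s * orient o q r = 0.
Proof. by rewrite !orientE; ring. Qed.

Lemma orient_conv p q x y (t : R) :
  orient p q ((1 - t) *: x + t *: y) = (1 - t) * orient p q x + t * orient p q y.
Proof. by rewrite !orientE !mxE; ring. Qed.

Lemma orient_sum p q A (w : plane -> R) : \sum_(x <- A) w x = 1 ->
  orient p q (\sum_(x <- A) w x *: x) = \sum_(x <- A) w x * orient p q x.
Proof.
move=> w1; rewrite orientE !summxE.
have E k c : \sum_(x <- A) (w x *: x) 0 k - c = \sum_(x <- A) w x * (x 0 k - c).
  under [RHS]eq_bigr do rewrite mulrBr; rewrite sumrB -mulr_suml w1 mul1r.
  by congr (_ - _); apply: eq_bigr => x _; rewrite mxE.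
rewrite !E !mulr_sumr -sumrB; apply: eq_bigr => x _; rewrite orientE; ring.
Qed.

Lemma plane_eqP x y : x 0 0 = y 0 0 -> x 0 1 = y 0 1 -> x = y.
Proof.
move=> h0 h1; apply/rowP => i; case: i => -[|[|//]] h.
- by move: h0; congr (x 0 _ = y 0 _); apply/val_inj.
- by move: h1; congr (x 0 _ = y 0 _); apply/val_inj.
Qed.

Lemma hull_in A p : p \in A -> hull A p.
Proof.
move=> pA; exists (fun q => (q == p)%:R); split.
- by move=> q _; case: eqP => _; rewrite ?ler01 ?lexx.
- rewrite (big_fsetD1 p) //= eqxx big_seq big1 ?addr0// => q.
  by rewrite !inE => /andP[/negPf ->].
- rewrite (big_fsetD1 p) //= eqxx scale1r big_seq big1 ?addr0// => q.
  by rewrite !inE => /andP[/negPf ->]; rewrite scale0r.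
Qed.

Lemma big_fset_sub (V : nmodType) A B (F : plane -> V) : {subset A <= B} ->
  \sum_(x <- B) (if x \in A then F x else 0) = \sum_(x <- A) F x.
Proof.
move=> AB; rewrite -big_mkcond /= -big_filter; apply: perm_big.
apply: uniq_perm; rewrite ?filter_uniq ?fset_uniq// => x.
rewrite mem_filter; apply/andP/idP => [[]//|xA]; split => //; exact: AB.
Qed.

Lemma hull_mono A B : {subset A <= B} -> hull A `<=` hull B.
Proof.
move=> AB x [w [w0 w1 ->]].
exists (fun p => if p \in A then w p else 0); split.
- by move=> p _; case: ifP => // pA; apply: w0.
- by rewrite big_fset_sub.
- rewrite -(big_fset_sub _ AB); apply: eq_bigr => p _.
  by case: ifP; rewrite ?scale0r.
Qed.

Lemma hull_conv A x y (t : R) : hull A x -> hull A y -> 0 <= t <= 1 ->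
  hull A ((1 - t) *: x + t *: y).
Proof.
move=> [w [w0 w1 ->]] [u [u0 u1 ->]] /andP[t0 t1].
exists (fun p => (1 - t) * w p + t * u p); split.
- by move=> p pA; rewrite addr_ge0 ?mulr_ge0 ?subr_ge0 ?w0 ?u0.
- by rewrite big_split/= -!mulr_sumr w1 u1; ring.
- rewrite !scaler_sumr -big_split/=; apply: eq_bigr => p _.
  by rewrite [RHS]scalerDl !scalerA.
Qed.

Lemma hull_ge0 A p q y : {in A, forall x, 0 <= orient p q x} -> hull A y ->
  0 <= orient p q y.
Proof.
move=> A0 [w [w0 w1 ->]]; rewrite orient_sum// big_seq sumr_ge0// => x xA.
by rewrite mulr_ge0 ?w0 ?A0.
Qed.

(** On a supporting line, a sum of nonnegative terms vanishes, so the points off the line have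
    weight 0. *)
Lemma hull_face A B p q y : {in A, forall x, 0 <= orient p q x} ->
  {in A, forall x, orient p q x = 0 -> x \in B} ->
  hull A y -> orient p q y = 0 -> hull (A `&` B)%fset y.
Proof.
move=> A0 AB [w [w0 w1 ->]]; rewrite orient_sum// => s0.
have s0' : {in A, forall x, w x * orient p q x = 0}.
  move=> x xA; apply/eqP; apply: contraTT isT => n0.
  suff : 0 < \sum_(x <- A) w x * orient p q x by rewrite s0 ltxx.
  rewrite (big_fsetD1 x)//= ltr_wpDr//.
    rewrite big_seq sumr_ge0// => z; rewrite !inE => /andP[_ zA].
    by rewrite mulr_ge0 ?w0 ?A0.
  by rewrite lt_neqAle eq_sym n0 mulr_ge0 ?w0 ?A0.
have wB x : x \in A -> x \notin (A `&` B)%fset -> w x = 0.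
  rewrite inE => xA; rewrite xA /= => xB; move/eqP: (s0' _ xA).
  rewrite mulf_eq0 => /orP[/eqP//|/eqP o0]; by rewrite (AB _ xA o0) in xB.
have sub : {subset (A `&` B)%fset <= A} by move=> x; rewrite inE => /andP[].
exists w; split.
- by move=> x /sub; apply: w0.
- rewrite -w1 -[LHS](big_fset_sub _ sub) big_seq [RHS]big_seq.
  by apply: eq_bigr => x xA; case: ifPn => // /(wB _ xA) ->.
- rewrite -[RHS](big_fset_sub _ sub) big_seq [RHS]big_seq.
  by apply: eq_bigr => x xA; case: ifPn => // /(wB _ xA) ->; rewrite scale0r.
Qed.

Lemma hull1 p : hull [fset p]%fset = [set p].
Proof.
apply/seteqP; split=> [y [w [_]]|y ->]; last by apply: hull_in; rewrite inE.
by rewrite !big_seq_fset1 => -> ->; rewrite scale1r.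
Qed.

Lemma hull0 : hull (fset0 : {fset plane}) = set0.
Proof.
apply/seteqP; split=> [y [w [_]]|//].
by rewrite big_seq_fset0 => /esym/eqP; rewrite oner_eq0.
Qed.

Lemma hull2P p q y : hull [fset p; q]%fset y <->
  exists t : R, 0 <= t <= 1 /\ y = (1 - t) *: p + t *: q.
Proof.
split=> [|[t [t01 ->]]]; last by apply: hull_conv => //; apply: hull_in; rewrite !inE eqxx ?orbT.
move=> [w [w0]]; have [<-|pq] := eqVneq p q.
  rewrite fsetUid !big_seq_fset1 => -> ->; exists 0.
  by rewrite lexx ler01 subr0 scale0r addr0.
have p2 : p \in [fset p; q]%fset by rewrite !inE eqxx.
rewrite (big_fsetD1 p p2) /= (big_fsetD1 p p2 (F := fun x => w x *: x)) /=.
have -> : ([fset p; q] `\ p)%fset = [fset q]%fset.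
  apply/fsetP => z; rewrite !inE; case: (eqVneq z p) => [->|_] //=.
  by rewrite (negPf pq).
rewrite !big_seq_fset1 => w1 ->; exists (w q).
have wp := w0 p; have wq := w0 q; rewrite !inE !eqxx ?orbT in wp wq.
have {}wp := wp isT; have {}wq := wq isT.
have -> : w p = 1 - w q by rewrite -w1; ring.
split => //; lra.
Qed.

(** Composed of two binary combinations, because x, y, z may coincide and weights on a set would
    then have to be merged. *)
Lemma hull_triple A x y z (a b c : R) : x \in A -> y \in A -> z \in A ->
  0 <= a -> 0 <= b -> 0 <= c -> a + b + c = 1 ->
  hull A (a *: x + b *: y + c *: z).
Proof.
move=> xA yA zA a0 b0 c0 abc; have [ab0|ab0] := eqVneq (a + b) 0.
  have [-> -> ->] : [/\ a = 0, b = 0 & c = 1] by split; lra.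
  by rewrite !scale0r !add0r scale1r; apply: hull_in.
have ab : 0 < a + b by rewrite lt_neqAle eq_sym ab0 addr_ge0.
have -> : a *: x + b *: y + c *: z =
    (1 - c) *: ((1 - b / (a + b)) *: x + (b / (a + b)) *: y) + c *: z.
  rewrite scalerDr !scalerA; congr (_ *: _ + _ *: _ + _).
    by rewrite (_ : 1 - c = a + b); [field|lra].
  by rewrite (_ : 1 - c = a + b); [field|lra].
apply: hull_conv; last 2 first.
- exact: hull_in.
- by rewrite c0 /=; lra.
apply: hull_conv; [exact: hull_in|exact: hull_in|].
by rewrite divr_ge0 ?(ltW ab)//= ler_pdivrMr// mul1r; lra.
Qed.

(** Cramer's rule: barycentric coordinates are quotients of signed areas. *)
Lemma triangle_bary p q r y : 0 < orient p q r -> y =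
  (orient q r y / orient p q r) *: p + (orient r p y / orient p q r) *: q
  + (orient p q y / orient p q r) *: r.
Proof.
move=> o0; have : orient p q r != 0 by rewrite gt_eqF.
by rewrite !orientE => n0; apply: plane_eqP; rewrite !mxE; field.
Qed.

Lemma triangleP p q r y : 0 < orient p q r ->
  hull [fset p; q; r]%fset y <->
  [/\ 0 <= orient p q y, 0 <= orient q r y & 0 <= orient r p y].
Proof.
move=> o0; split=> [h|[h1 h2 h3]].
  have o1 : 0 < orient q r p by rewrite -orient_rot.
  have o2 : 0 < orient r p q by rewrite -orient_rot.
  by split; apply: hull_ge0 h => x; rewrite !inE -orbA => /or3P[] /eqP ->;
    rewrite ?orient_ids ?orient_idr ?orient_idl // ltW.
rewrite (triangle_bary y o0); apply: hull_triple.
- by rewrite !inE eqxx.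
- by rewrite !inE eqxx orbT.
- by rewrite !inE eqxx orbT.
- by rewrite divr_ge0 ?(ltW o0).
- by rewrite divr_ge0 ?(ltW o0).
- by rewrite divr_ge0 ?(ltW o0).
rewrite -!mulrDl; apply: (@mulIf _ (orient p q r)); first by rewrite gt_eqF.
rewrite divfK ?gt_eqF// mul1r !orientE; ring.
Qed.

Lemma hull3_weights p q r y : 0 < orient p q r -> hull [fset p; q; r]%fset y ->
  exists a b c : R, [/\ 0 <= a, 0 <= b, 0 <= c, a + b + c = 1 &
    y = a *: p + b *: q + c *: r].
Proof.
move=> o0 /(triangleP _ o0)[h1 h2 h3].
exists (orient q r y / orient p q r), (orient r p y / orient p q r),
  (orient p q y / orient p q r); split; rewrite ?divr_ge0 ?(ltW o0)//.
  rewrite -!mulrDl; apply: (@mulIf _ (orient p q r)); first by rewrite gt_eqF.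
  by rewrite divfK ?gt_eqF// mul1r !orientE; ring.
exact: triangle_bary.
Qed.

Lemma orient_triple p q x y z (a b c : R) : a + b + c = 1 ->
  orient p q (a *: x + b *: y + c *: z) =
  a * orient p q x + b * orient p q y + c * orient p q z.
Proof.
by move=> abc; rewrite (_ : a = 1 - b - c) ?orientE ?mxE; [ring|lra].
Qed.

(** Seen from z, the signed areas z a b and z b c add up to z a c, and their proportions locate b on
    the segment. *)
Lemma collinear_between z a b c : orient a b c = 0 -> 0 <= orient z a b ->
  0 <= orient z b c -> 0 < orient z a c -> hull [fset a; c]%fset b.
Proof.
move=> o0 h1 h2 h3; apply/hull2P.
have e : orient z a b + orient z b c = orient z a c.
  by apply/eqP; rewrite -subr_eq0 -o0 !orientE; apply/eqP; ring.
exists (orient z a b / orient z a c); split.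
  by rewrite divr_ge0 ?(ltW h3)//= ler_pdivrMr// mul1r -e lerDl.
have e2 : (1 - orient z a b / orient z a c) = orient z b c / orient z a c.
  by rewrite -e; field; rewrite e gt_eqF.
rewrite e2; have n0 : orient z a c != 0 by rewrite gt_eqF.
have h k : orient z a c * b 0 k = orient z b c * a 0 k + orient z a b * c 0 k ->
  b 0 k = ((orient z b c / orient z a c) *: a + (orient z a b / orient z a c) *: c) 0 k.
  move=> E; rewrite !mxE; apply: (mulfI n0); rewrite E; field; exact: n0.
(* The linear relation between a, b, c and z in the plane; its z-coefficient vanishes by
   collinearity. *)
have id k : orient z b c * a 0 k + orient z a b * c 0 k - orient z a c * b 0 k
   = orient a b c * z 0 k.
  have : k = 0 \/ k = 1 by case: k => -[|[|//]] ?; [left|right]; apply: val_inj.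
  by case=> ->; rewrite !orientE; ring.
apply: plane_eqP; apply: h; apply/eqP; rewrite eq_sym -subr_eq0 id o0 mul0r//.
Qed.

End Orientation.

(** * Proper intersection of triangles *)

Section MeetProperly.
Variable R : realType.
Notation plane := 'rV[R]_2.
Implicit Types (p q r y : plane) (t u : {fset plane}).

Lemma meet_properly_sym t u : meet_properly t u -> meet_properly u t.
Proof.
rewrite /meet_properly setIC => -[|[p [? ? ?]]|[p [q [? ? ? ?]]]].
- by constructor 1.
- by constructor 2; exists p.
- by constructor 3; exists p, q.
Qed.

Lemma no_vertex_in_hull2 p q r : orient p q r != 0 -> ~ hull [fset q; r]%fset p.
Proof.
move=> n0 /hull2P[t [_ e]]; move: n0; rewrite orient_rot e orient_conv.
by rewrite orient_ids orient_idr !mulr0 addr0 eqxx.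
Qed.

(** In the case of a common edge, p lies on an edge of u; since u is non-degenerate, p is one of its
    two ends and hence belongs to t. *)
Lemma meet_properly_vertex t u p : is_triangle u -> meet_properly t u ->
  p \in u -> hull t p -> p \in t.
Proof.
move=> [a [b [c [uE o0]]]] m pu tp.
have {}tp : (hull t `&` hull u) p by split => //; exact: hull_in.
case: m => [e|[q [qt _ e]]|[q [r [qr [qt rt] [qu ru] e]]]].
- by move: tp; rewrite e.
- by move: tp; rewrite e => ->.
move: tp; rewrite e /segment => h.
have [->//|pq] := eqVneq p q; have [->//|pr] := eqVneq p r; exfalso.
have {}h d1 d2 : q \in [fset d1; d2]%fset -> r \in [fset d1; d2]%fset ->
    hull [fset d1; d2]%fset p.
  move=> h1 h2; move: p h {pu pq pr}.
  by apply: hull_mono => z; rewrite in_fset2 => /orP[] /eqP ->.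
have o1 : orient b c a != 0 by rewrite -orient_rot.
have o2 : orient c a b != 0 by rewrite -orient_rot.
move: pu qu ru pq pr; rewrite uE !inE -!orbA.
case/or3P => /eqP pE; rewrite pE in h *.
- move=> qu ru aq ar; apply: (no_vertex_in_hull2 o0); apply: h; rewrite !inE.
    by move: qu; rewrite eq_sym (negPf aq).
  by move: ru; rewrite eq_sym (negPf ar).
- move=> qu ru aq ar; apply: (no_vertex_in_hull2 o1); apply: h; rewrite !inE orbC.
    by move: qu; rewrite [q == b]eq_sym (negPf aq).
  by move: ru; rewrite [r == b]eq_sym (negPf ar).
- move=> qu ru aq ar; apply: (no_vertex_in_hull2 o2); apply: h; rewrite !inE.
    by move: qu; rewrite [q == c]eq_sym (negPf aq) orbF.
  by move: ru; rewrite [r == c]eq_sym (negPf ar) orbF.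
Qed.

(** A proper intersection is empty or a face of dimension at most 1, hence lies on the boundary of
    the triangle. *)
Lemma meet_properly_inner a b c u y : meet_properly [fset a; b; c]%fset u ->
  0 < orient a b y -> 0 < orient b c y -> 0 < orient c a y -> ~ hull u y.
Proof.
move=> m h1 h2 h3 uy.
have oabc : 0 < orient a b c.
  have e : orient a b c = orient a b y + orient b c y + orient c a y.
    by rewrite !orientE; ring.
  lra.
have ty : (hull [fset a; b; c]%fset `&` hull u) y.
  by split => //; apply/triangleP => //; split; exact: ltW.
case: m => [e|[q [qt _ e]]|[q [r [qr [qt rt] [qu ru] e]]]].
- by move: ty; rewrite e.
- move: ty; rewrite e => yq; move: qt; rewrite -yq !inE -orbA.
  case/or3P => /eqP E; move: h1 h2 h3; rewrite E.
  + by rewrite orient_ids ltxx.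
  + by rewrite orient_idr ltxx.
  + by rewrite orient_idr ltxx.
- move: ty; rewrite e => /hull2P[s [s01 ys]].
  have hh d1 d2 : 0 < orient d1 d2 y -> orient d1 d2 q = 0 ->
      orient d1 d2 r = 0 -> False.
    by move=> h eq er; move: h; rewrite ys orient_conv eq er !mulr0 addr0 ltxx.
  move: qr; move: qt rt; rewrite !inE -!orbA.
  case/or3P => /eqP qE; case/or3P => /eqP rE; rewrite qE rE ?eqxx //= => _.
  all: move: (hh _ _ h1) (hh _ _ h2) (hh _ _ h3); rewrite qE rE.
  all: rewrite ?orient_ids ?orient_idr => k1 k2 k3.
  all: by [exact: k1|exact: k2|exact: k3].
Qed.

(** The intersection lies on the separating line, where [hull_face] reduces both hulls to those of
    their vertices among p and r. Four cases remain, according to which of p and r are common. *)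
Lemma meet_properly_separated p r t u : p != r ->
  {in t, forall z, 0 <= orient p r z} ->
  {in u, forall z, orient p r z <= 0} ->
  {in t, forall z, orient p r z = 0 -> z \in [fset p; r]%fset} ->
  {in u, forall z, orient p r z = 0 -> z \in [fset p; r]%fset} ->
  meet_properly t u.
Proof.
move=> pr t0 u0 tE uE.
have u0' : {in u, forall z, 0 <= orient r p z}.
  by move=> z /u0; rewrite orient_flip oppr_le0.
have uE' : {in u, forall z, orient r p z = 0 -> z \in [fset p; r]%fset}.
  move=> z zu e; apply: uE => //.
  by rewrite orient_flip e oppr0.
have key y : hull t y -> hull u y ->
   hull (t `&` [fset p; r])%fset y /\ hull (u `&` [fset p; r])%fset y.
  move=> ty uy; have h1 := hull_ge0 t0 ty; have h2 := hull_ge0 u0' uy.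
  have e : orient p r y = 0.
    by move: h1 h2; rewrite (orient_flip r p y); lra.
  split; first exact: hull_face t0 tE ty e.
  by apply: hull_face u0' uE' uy _; rewrite orient_flip e oppr0.
have sub2 (v : {fset plane}) : p \notin v -> hull (v `&` [fset p; r])%fset `<=` hull [fset r]%fset.
  move=> pv; apply: hull_mono => z; rewrite !inE => /andP[zv /orP[/eqP zp|//]].
  by rewrite -zp zv in pv.
have sub1 (v : {fset plane}) : r \notin v -> hull (v `&` [fset p; r])%fset `<=` hull [fset p]%fset.
  move=> rv; apply: hull_mono => z; rewrite !inE => /andP[zv /orP[//|/eqP zr]].
  by rewrite -zr zv in rv.
have mem (v : {fset plane}) : hull (v `&` [fset p; r])%fset p -> p \in v.
  by move=> h; apply: contraT => /sub2 /(_ _ h); rewrite hull1 => /eqP; rewrite (negPf pr).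
have mem' (v : {fset plane}) : hull (v `&` [fset p; r])%fset r -> r \in v.
  by move=> h; apply: contraT => /sub1 /(_ _ h); rewrite hull1 => /eqP; rewrite eq_sym (negPf pr).
have seg (v : {fset plane}) : hull (v `&` [fset p; r])%fset `<=` hull [fset p; r]%fset.
  by apply: hull_mono => z; rewrite inE => /andP[].
have [/andP[pt pu]|pN] := boolP ((p \in t) && (p \in u));
have [/andP[rt ru]|rN] := boolP ((r \in t) && (r \in u)).
- constructor 3; exists p, r; split => //; apply/seteqP; split=> [y [ty uy]|y h].
    by have [h _] := key y ty uy; exact: seg h.
  by split; move: y h; apply: hull_mono => z; rewrite in_fset2 => /orP[] /eqP ->.
- constructor 2; exists p; split => //; apply/seteqP; split=> [y [ty uy]|y ->].
    have [h1 h2] := key y ty uy; rewrite -hull1.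
    by move: rN; rewrite negb_and => /orP[] /sub1; apply.
  by split; exact: hull_in.
- constructor 2; exists r; split => //; apply/seteqP; split=> [y [ty uy]|y ->].
    have [h1 h2] := key y ty uy; rewrite -hull1.
    by move: pN; rewrite negb_and => /orP[] /sub2; apply.
  by split; exact: hull_in.
- constructor 1; apply/seteqP; split=> [y [ty uy]|//].
  have [h1 h2] := key y ty uy.
  have yp : y = p by move: rN; rewrite negb_and => /orP[] /sub1 s;
    [move: (s _ h1)|move: (s _ h2)]; rewrite hull1.
  move: h1 h2 pN; rewrite yp => /mem pt /mem pu.
  by rewrite pt pu.
Qed.

(** Closedness of a finite union of triangles, in the form of a limit along a segment ending at
    y. *)
Lemma cover_limit (T : seq {fset plane}) y z :
  (forall t, t \in T -> exists a b c, t = [fset a; b; c]%fset /\ 0 < orient a b c) ->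
  (forall e : R, 0 < e <= 1 -> exists2 t, t \in T & hull t ((1 - e) *: y + e *: z)) ->
  exists2 t, t \in T & hull t y.
Proof.
move=> Ttri cov; apply: contrapT => H.
(* A triangle that misses y misses all the points of ]y, z] close to y. *)
have far t : t \in T -> exists2 d : R, 0 < d &
    forall e, 0 < e < d -> ~ hull t ((1 - e) *: y + e *: z).
  move=> tT; have [a [b [c [tE o0]]]] := Ttri t tT.
  have ny : ~ hull t y by move=> h; apply: H; exists t.
  have one p q : orient p q y < 0 ->
      {in t, forall v, 0 <= orient p q v} -> exists2 d : R, 0 < d &
      forall e, 0 < e < d -> ~ hull t ((1 - e) *: y + e *: z).
    move=> h hv; set al := orient p q y in h; set be := orient p q z.
    have hp : 0 < `|be - al| + 1 by rewrite ltr_wpDl.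
    (* Along the segment the orientation equals al + e (be - al), which stays negative below this
       bound; the added 1 avoids a zero denominator. *)
    exists (- al / (`|be - al| + 1)); first by rewrite divr_gt0// oppr_gt0.
    move=> e /andP[e0]; rewrite ltr_pdivlMr// => he hu.
    have := hull_ge0 hv hu; rewrite orient_conv -/al -/be => k.
    have := ler_wpM2l (ltW e0) (ler_norm (be - al)); lra.
  have o1 : 0 < orient b c a by rewrite -orient_rot.
  have o2 : 0 < orient c a b by rewrite -orient_rot.
  have [h1|h1] := ltP (orient a b y) 0.
    apply: (one _ _ h1) => v; rewrite tE !inE -orbA => /or3P[] /eqP ->;
      by rewrite ?orient_ids ?orient_idr // ltW.
  have [h2|h2] := ltP (orient b c y) 0.
    apply: (one _ _ h2) => v; rewrite tE !inE -orbA => /or3P[] /eqP ->;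
      by rewrite ?orient_ids ?orient_idr // ltW.
  have [h3|h3] := ltP (orient c a y) 0.
    apply: (one _ _ h3) => v; rewrite tE !inE -orbA => /or3P[] /eqP ->;
      by rewrite ?orient_ids ?orient_idr // ltW.
  by exfalso; apply: ny; rewrite tE; apply/triangleP.
have [d d0 hd] : exists2 d : R, 0 < d & forall t, t \in T ->
    forall e, 0 < e < d -> ~ hull t ((1 - e) *: y + e *: z).
  move: far; elim: (T) => [|t s IH] far; first by exists 1.
  have [|d1 d10 h1] := IH; first by move=> u us; apply: far; rewrite inE us orbT.
  have [|d2 d20 h2] := far t; first by rewrite inE eqxx.
  exists (Num.min d1 d2); first by rewrite lt_min d10.
  move=> u; rewrite inE => /orP[/eqP ->|us] e /andP[e0].
    by rewrite lt_min => /andP[_ he]; apply: h2; rewrite e0.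
  by rewrite lt_min => /andP[he _]; apply: h1; rewrite ?e0.
pose e := Num.min (d / 2) 1.
have e0 : 0 < e by rewrite lt_min ltr01 andbT divr_gt0.
have [|t tT ht] := cov e; first by rewrite e0 /= ge_min lexx orbT.
apply: (hd t tT e) => //; rewrite e0 /= gt_min; apply/orP; left.
by rewrite ltr_pdivrMr// ltr_pMr// ltr1n.
Qed.

End MeetProperly.

(** * Triangulations of chains of points in weakly convex position *)

(* [lia] is very slow on boolean hypotheses and in large contexts: [nlia] keeps
   the arithmetic hypotheses only and turns them into propositions. *)
Ltac nat_bool b :=
  lazymatch b with
  | leq _ _ => idtac
  | andb ?c ?d => nat_bool c; nat_bool d
  | orb ?c ?d => nat_bool c; nat_bool d
  | negb ?c => nat_bool c
  | @eq_op _ ?n _ => let T := type of n in constr_eq T nat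
  end.

Ltac nat_prop P :=
  lazymatch P with
  | nat => idtac
  | is_true ?b => nat_bool b
  | @eq _ ?n _ => let T := type of n in constr_eq T nat
  | ~ ?Q => nat_prop Q
  | ?Q \/ ?Q' => nat_prop Q; nat_prop Q'
  | ?Q /\ ?Q' => nat_prop Q; nat_prop Q'
  end.

Ltac nat_hyps :=
  repeat match goal with
  | H : ?P |- _ => tryif nat_prop P then fail else clear H
  end;
  repeat match goal with
  | H : is_true (_ && _) |- _ => case/andP: H => ? ?
  | H : is_true (leq _ _) |- _ => move/leP: H => H
  | H : is_true (negb (leq _ _)) |- _ => rewrite -ltnNge in H
  | H : is_true (negb (_ == _)) |- _ => move/eqP: H => H
  | H : is_true (_ == _) |- _ => move/eqP: H => H
  end.

Ltac nlia :=
  nat_hyps;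
  repeat match goal with
  | |- is_true (_ && _) => apply/andP; split
  | |- is_true (leq _ _) => apply/leP
  | |- is_true (_ != _) => apply/eqP
  end; lia.

Section Chain.
Variable R : realType.
Notation plane := 'rV[R]_2.
(* For i < j, [S i j] says that x_i and x_j lie on a common side; the last side
   consists of x_A, ..., x_(N-1) and x_0. *)
Variables (x : nat -> plane) (N A : nat) (S : nat -> nat -> bool).
Hypothesis S_succ : forall a, (a.+1 < N)%N -> S a a.+1.
Hypothesis S_sub : forall a b c d, (a <= b)%N -> (c <= d)%N -> S a d -> S b c.
Hypothesis x_inj : {in [pred n | n < N]%N &, injective x}.
Hypothesis orient_ge0 : forall a b c, (a < b)%N -> (b < c)%N -> (c < N)%N ->
  0 <= orient (x a) (x b) (x c).
Hypothesis orient_eq0 : forall a b c, (a < b)%N -> (b < c)%N -> (c < N)%N ->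
  (orient (x a) (x b) (x c) == 0) = S a c || ((a == 0) && (A <= b))%N.

Local Notation o a b c := (orient (x a) (x b) (x c)).

Definition chain (i j : nat) : {fset plane} :=
  [fset x n | n in iota i (j.+1 - i)]%fset.

Definition tri (a b c : nat) : {fset plane} := [fset x a; x b; x c]%fset.

(* The polygon with vertices x_i, ..., x_j, whose closing edge, from x_j back
   to x_i, lies on the side of the polygon that contains x_B, ..., x_j, x_i. *)
Record polygon (i j B : nat) : Prop := Polygon {
  pg_iB : (i < B)%N;
  pg_Bj : (B <= j)%N;
  pg_jN : (j < N)%N;
  pg_B : (B = j /\ (0 < i \/ j <= A)%N) \/ (i = 0%N /\ B = A);
  pg_nS : ~~ S i B
}.

Lemma chainP i j p : reflect (exists2 n, (i <= n <= j)%N & p = x n) (p \in chain i j).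
Proof.
apply: (iffP (imfsetP _ _ _ _)) => -[n /=].
  by rewrite mem_iota => h ->; exists n => //; nlia.
by move=> h ->; exists n => //; rewrite mem_iota; nlia.
Qed.

Lemma chain_in i j n : (i <= n <= j)%N -> x n \in chain i j.
Proof. by move=> h; apply/chainP; exists n. Qed.

Lemma chain_sub i j i' j' : (i <= i')%N -> (j' <= j)%N -> {subset chain i' j' <= chain i j}.
Proof. by move=> h1 h2 p /chainP[n h ->]; apply: chain_in; nlia. Qed.

Lemma chain_orient_ge0 a b c : (a <= b)%N -> (b <= c)%N -> (c < N)%N -> 0 <= o a b c.
Proof.
rewrite leq_eqVlt => /orP[/eqP -> _ _|ab]; first by rewrite orient_idl.
rewrite leq_eqVlt => /orP[/eqP -> _|bc cN]; first by rewrite orient_idr.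
exact: orient_ge0.
Qed.

(** If B = j, the exceptional clauses about A and about B are both void; otherwise i = 0 and B = A,
    and they coincide. *)
Lemma chain_orient_eq0 i j B a b c : polygon i j B -> (i <= a)%N -> (a < b)%N -> (b < c)%N ->
  (c <= j)%N -> (o a b c == 0) = S a c || ((a == i) && (B <= b))%N.
Proof.
move=> P ia ab bc cj; have jN := pg_jN P; rewrite orient_eq0//; last nlia.
by case: (pg_B P) => -[h1 h2]; congr (_ || _); nlia.
Qed.

Lemma chain_orient_gt0 i j B a b c : polygon i j B -> (i <= a)%N -> (a < b)%N -> (b < c)%N ->
  (c <= j)%N -> ~~ S a c -> ~~ ((a == i) && (B <= b))%N -> 0 < o a b c.
Proof.
move=> P ia ab bc cj h1 h2; rewrite lt_neqAle eq_sym (chain_orient_eq0 P)//.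
rewrite (negPf h1) (negPf h2) /= orient_ge0//; have := pg_jN P; nlia.
Qed.

Lemma off_side_widen a b c d : (a <= b)%N -> (c <= d)%N -> ~~ S b c -> ~~ S a d.
Proof. by move=> h1 h2; apply: contra; apply: S_sub. Qed.

Lemma polygon_closing_gt i j B : polygon i j B -> (i.+1 < B)%N.
Proof.
case=> iB Bj jN _ nS; rewrite ltn_neqAle iB andbT; apply: contra nS => /eqP <-.
by apply: S_succ; nlia.
Qed.

Lemma chain_edge_ge0 i j a c : (j < N)%N -> (i <= a < j)%N -> (i <= c <= j)%N ->
  0 <= o a a.+1 c.
Proof.
move=> jN ha hc; have [h|h] := leqP c a; first by rewrite -orient_rot chain_orient_ge0; nlia.
by apply: chain_orient_ge0; nlia.
Qed.

Lemma chain_close_ge0 i j c : (j < N)%N -> (i <= c <= j)%N -> 0 <= o j i c.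
Proof. by move=> jN hc; rewrite orient_rot; apply: chain_orient_ge0; nlia. Qed.

(** Conversely, a point satisfying the edge inequalities is found in a triangle of the fan at x_i,
    by a discrete intermediate value argument. [Q] accepts outright every x_c on a side with x_i,
    where the fan triangles are degenerate. *)
Lemma hull_chainP i j B y : polygon i j B -> hull (chain i j) y <->
  (forall a, (i <= a < j)%N -> 0 <= orient (x a) (x a.+1) y)
    /\ 0 <= orient (x j) (x i) y.
Proof.
move=> P; have [iB Bj jN _ nS] := P; have iB1 := polygon_closing_gt P.
split=> [h|[h1 h2]].
  split=> [a ha|].
    by apply: hull_ge0 h => p /chainP[n hn ->]; apply: chain_edge_ge0 hn.
  by apply: hull_ge0 h => p /chainP[n hn ->]; apply: chain_close_ge0.
(* Look for the triangle of the fan with apex x_i that contains y. *)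
pose Q c := S i c || (0 < orient (x i) (x c) y).
have oB c : (i < c < B)%N -> 0 < o i c B.
  by move=> hc; apply: (chain_orient_gt0 P) => //; nlia.
(* If B < j, then x_B and x_j are on one ray from x_i, and the Plucker relation carries the sign
   from the closing edge to x_B. *)
have fB : orient (x i) (x B) y <= 0.
  rewrite leNgt; apply/negP => fB; have h3 : orient (x i) (x j) y <= 0.
    by rewrite orient_flip oppr_le0.
  have [Bj'|Bj'] := eqVneq B j; first by rewrite -Bj' leNgt fB in h3.
  have o1 := oB i.+1 ltac:(nlia).
  have o2 : 0 < o i i.+1 j.
    by apply: (chain_orient_gt0 P) => //; [nlia|apply: off_side_widen nS; nlia|nlia].
  have o3 : o i B j = 0.
    by apply/eqP; rewrite (chain_orient_eq0 P)//; [rewrite eqxx leqnn orbT|nlia].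
  have := orient_plucker (x i) (x B) (x j) (x i.+1) y.
  rewrite o3 mul0r add0r (orient_swap _ (x B)) (orient_swap _ (x j) (x i.+1)).
  nra.
have QB : ~~ Q B by rewrite /Q (negPf nS) /= -leNgt.
have [c [hc Qc nQ]] : exists c, [/\ (i < c < B)%N, Q c & ~~ Q c.+1].
  have Q1 : Q i.+1 by rewrite /Q S_succ//; nlia.
  apply: contrapT => H; have QQ d : (i.+1 + d <= B)%N -> Q (i.+1 + d)%N.
    elim: d => [|d IH] h; first by rewrite addn0.
    apply: contraT => nQ; exfalso; apply: H; exists (i.+1 + d)%N; split.
    - nlia.
    - by apply: IH; nlia.
    - by rewrite -addnS.
  have := QQ (B - i.+1)%N ltac:(nlia); rewrite (_ : i.+1 + (B - i.+1) = B)%N; last nlia.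
  by rewrite (negPf QB).
have {QB fB}fc : 0 <= orient (x i) (x c) y.
  have /orP[Sc|/ltW//] := Qc; have [->|ic] := eqVneq c i.+1; first by apply: h1; nlia.
  have o1 := oB i.+1 ltac:(nlia); have o2 := oB c hc.
  have o3 : o i i.+1 c = 0.
    by apply/eqP; rewrite (chain_orient_eq0 P)//; [rewrite Sc|nlia|nlia].
  have := orient_plucker (x i) (x i.+1) (x c) (x B) y.
  by rewrite o3 mul0r add0r; have := h1 i ltac:(nlia); nra.
move: nQ; rewrite /Q negb_or -leNgt => /andP[nSc fc1].
have oc : 0 < o i c c.+1 by apply: (chain_orient_gt0 P) => //; nlia.
have : hull (tri i c c.+1) y.
  apply/triangleP => //; split => //; first by apply: h1; nlia.
  by rewrite orient_flip oppr_ge0.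
apply: hull_mono => p; rewrite !inE -orbA => /or3P[] /eqP ->; apply: chain_in; nlia.
Qed.

(** Normal form of an unordered triangle: an increasing triple never turns clockwise, so a
    non-degenerate one is counterclockwise. *)
Lemma chain_triangle i j t : (j < N)%N -> is_triangle t -> (t `<=` chain i j)%fset ->
  exists a b c, [/\ (i <= a)%N, (a < b)%N, (b < c)%N, (c <= j)%N & t = tri a b c /\ 0 < o a b c].
Proof.
move=> jN [p [q [r [-> o0]]]] /fsubsetP sub.
have [a ha pE] := chainP _ _ _ (sub p ltac:(by rewrite !inE eqxx)).
have [b hb qE] := chainP _ _ _ (sub q ltac:(by rewrite !inE eqxx orbT)).
have [c hc rE] := chainP _ _ _ (sub r ltac:(by rewrite !inE eqxx !orbT)).
subst p q r.
have pos u v w : (u < v)%N -> (v < w)%N -> (w <= j)%N -> o u v w != 0 -> 0 < o u v w.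
  by move=> uv vw wj n0; rewrite lt_neqAle eq_sym n0 orient_ge0//; nlia.
have ab : a != b by apply: contraNneq o0 => ->; rewrite orient_idl.
have bc : b != c by apply: contraNneq o0 => ->; rewrite orient_idr.
have ac : a != c by apply: contraNneq o0 => ->; rewrite orient_ids.
have fin u v w : (i <= u)%N -> (u < v)%N -> (v < w)%N -> (w <= j)%N -> o u v w != 0 ->
    tri a b c = tri u v w ->
    exists u v w, [/\ (i <= u)%N, (u < v)%N, (v < w)%N, (w <= j)%N &
      tri a b c = tri u v w /\ 0 < o u v w].
  by move=> *; exists u, v, w; split => //; split => //; exact: pos.
have e u v w (H : perm_eq [:: a; b; c] [:: u; v; w]) : tri a b c = tri u v w.
  apply/fsetP => p; rewrite !inE -!orbA.
  have -> : (p == x a) || ((p == x b) || (p == x c)) = has (fun n => p == x n) [:: a; b; c].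
    by rewrite /= orbF.
  by rewrite (perm_has _ H) /= orbF.
have [ab'|ba] := ltnP a b; have [bc'|cb] := ltnP b c; have [ac'|ca] := ltnP a c.
- by apply: (fin a b c) => //; nlia.
- nlia.
- apply: (fin a c b) => //; try nlia; first by rewrite orient_swap oppr_eq0.
  by apply: e; apply/permP => f /=; nlia.
- apply: (fin c a b) => //; try nlia; first by rewrite orient_rot.
  by apply: e; apply/permP => f /=; nlia.
- apply: (fin b a c) => //; try nlia; first by rewrite orient_flip oppr_eq0.
  by apply: e; apply/permP => f /=; nlia.
- apply: (fin b c a) => //; try nlia; first by rewrite -orient_rot.
  by apply: e; apply/permP => f /=; nlia.
- nlia.
- apply: (fin c b a) => //; try nlia; first by rewrite orient_rot orient_flip oppr_eq0.
  by apply: e; apply/permP => f /=; nlia.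
Qed.

Lemma tri_vertex a b c n : (a < N)%N -> (b < N)%N -> (c < N)%N -> (n < N)%N ->
  x n \in tri a b c -> [\/ n = a, n = b | n = c].
Proof.
move=> aN bN cN nN; rewrite !inE -orbA => /or3P[] /eqP /x_inj h.
- by constructor 1; apply: h.
- by constructor 2; apply: h.
- by constructor 3; apply: h.
Qed.

(** * The triangle on the closing side, and the position of the others *)

(** The hull of a chain inside a side is a nonempty segment, which the empty set does not cover;
    hence the separate convention. *)
Definition chain_triangulation i j (T : {fset {fset plane}}) : Prop :=
  if S i j then T = fset0 else triangulation (chain i j) T.

Lemma base_triangle i j B T : polygon i j B -> triangulation (chain i j) T ->
  exists k q, [/\ (i < k)%N, (k < B)%N, (B <= q)%N, (q <= j)%N & tri i k q \in T].
Proof.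
move=> P [Ttri Tcov _]; have [iB Bj jN _ nS] := P; have iB1 := polygon_closing_gt P.
(* A triangle that covers the midpoint of the segment from x_j to x_i has an edge
   on the closing side, with endpoint x_i. *)
pose m := (1 - 1 / 2) *: x j + (1 / 2) *: x i.
have of_ : 0 < o i i.+1 j.
  by apply: (chain_orient_gt0 P) => //; [nlia|apply: off_side_widen nS; nlia|nlia].
have phi0 : orient (x j) (x i) m = 0.
  by rewrite orient_conv orient_ids orient_idr !mulr0 addr0.
have fm : 0 < orient (x i.+1) (x j) m.
  by rewrite orient_conv orient_idr mulr0 add0r -orient_rot mulr_gt0.
have : hull (chain i j) m.
  apply: hull_conv; [apply: hull_in; apply: chain_in; nlia..|].
  by apply/andP; split; lra.
rewrite -Tcov => -[t /= tT].
have [/(chain_triangle jN) ttri /ttri[a [b [c [ia ab bc cj [tE o0]]]]]] := Ttri t tT.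
rewrite tE => /(hull3_weights o0)[al [be [ga [al0 be0 ga0 s1 mE]]]].
rewrite mE orient_triple// in phi0; rewrite mE orient_triple// in fm.
(* At m the form of the closing edge vanishes, so a vertex of positive weight is x_i or one of x_B,
   ..., x_j. On the latter the form of the line x_(i+1) x_j is at most 0, whereas it is positive at
   m: x_i must be a vertex. *)
have far d (w : R) : (i < d <= j)%N -> 0 <= w -> w * o j i d <= 0 -> w * o i.+1 j d <= 0.
  move=> hd w0 h; have [Bd|dB] := leqP B d.
    rewrite mulr_ge0_le0//; have [->|dj] := eqVneq d j; first by rewrite orient_idr.
    by rewrite orient_swap oppr_le0; apply: chain_orient_ge0; nlia.
  suff -> : w = 0 by rewrite mul0r.
  have : 0 < o j i d.
    rewrite orient_rot; apply: (chain_orient_gt0 P) => //; try nlia.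
    by apply: off_side_widen nS; nlia.
  move=> h'; apply/eqP; rewrite eq_le w0 andbT leNgt; apply/negP => w1.
  by have := mulr_gt0 w1 h'; rewrite ltNge h.
have ge d (w : R) : (i <= d <= j)%N -> 0 <= w -> 0 <= w * o j i d.
  by move=> hd w0; rewrite mulr_ge0// (chain_close_ge0 jN hd).
have ga1 := ge a al ltac:(nlia) al0; have gb1 := ge b be ltac:(nlia) be0.
have gc1 := ge c ga ltac:(nlia) ga0.
have fb := far b be ltac:(nlia) be0 ltac:(lra).
have fc := far c ga ltac:(nlia) ga0 ltac:(lra).
have ai : a = i.
  apply/eqP; apply: contraTT fm => ai; have fa := far a al ltac:(nlia) al0 ltac:(lra).
  by rewrite -leNgt; lra.
have bB : (b < B)%N.
  rewrite ltnNge; apply/negP => Bb; move: o0; rewrite ai lt_neqAle eq_sym.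
  by rewrite (chain_orient_eq0 P) ?eqxx ?Bb ?orbT//; nlia.
exists b, c; split; [nlia|nlia| |nlia|by rewrite -ai -tE].
(* If c < B, then x_b and x_c are both off the closing line, their weights vanish, and m would be
   x_i. *)
rewrite leqNgt; apply/negP => cB; move: mE.
have pos d : (i < d < B)%N -> 0 < o j i d.
  move=> hd; rewrite orient_rot; apply: (chain_orient_gt0 P) => //; try nlia.
  by apply: off_side_widen nS; nlia.
have be00 : be = 0.
  have h := pos b ltac:(nlia); apply/eqP; apply: contraT => n0.
  have : 0 < be * o j i b by rewrite mulr_gt0// lt_neqAle eq_sym n0.
  lra.
have ga00 : ga = 0.
  have h := pos c ltac:(nlia); apply/eqP; apply: contraT => n0.
  have : 0 < ga * o j i c by rewrite mulr_gt0// lt_neqAle eq_sym n0.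
  lra.
have al1 : al = 1 by lra.
rewrite be00 ga00 al1 !scale0r !addr0 scale1r ai => me.
have : orient (x i.+1) (x j) m = orient (x i.+1) (x j) (x i) by rewrite me.
rewrite orient_conv orient_idr mulr0 add0r -(orient_rot (x i)).
by move: of_; lra.
Qed.

(** A vertex of u in the closed triangle x_i x_k x_q is one of its vertices, and no edge of u
    crosses that triangle. Beyond x_q x_i there are at most collinear points, so u stays on one side
    of x_k. *)
Lemma split_triangle i j B k q u : polygon i j B ->
  (i < k < B)%N -> (B <= q <= j)%N -> is_triangle u -> (u `<=` chain i j)%fset ->
  meet_properly (tri i k q) u -> u != tri i k q ->
  (u `<=` chain i k)%fset || (u `<=` chain k q)%fset.
Proof.
move=> P hk hq utri usub m une; have [iB Bj jN _ nS] := P.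
have okq : 0 < o i k q.
  by apply: (chain_orient_gt0 P) => //; try nlia; apply: off_side_widen nS; nlia.
have ttri : is_triangle (tri i k q).
  by exists (x i), (x k), (x q); split => //; rewrite gt_eqF.
have [a [b [c [ia ab bc cj [uE o0]]]]] := chain_triangle jN utri usub.
have au : x a \in u by rewrite uE !inE eqxx.
have bu : x b \in u by rewrite uE !inE eqxx orbT.
have cu : x c \in u by rewrite uE !inE eqxx !orbT.
have vin n : (i <= n <= j)%N -> x n \in u -> 0 <= o i k n -> 0 <= o k q n ->
    0 <= o q i n -> [\/ n = i, n = k | n = q].
  move=> hn nu h1 h2 h3; apply: tri_vertex; try nlia.
  by apply: (meet_properly_vertex utri m nu); apply/triangleP.
have win n : [\/ n = i, n = k | n = q] -> hull u (x n) -> x n \in u.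
  move=> hn; apply: (meet_properly_vertex ttri (meet_properly_sym m)).
  by case: hn => ->; rewrite !inE eqxx ?orbT.
have udeg n1 n2 n3 : (n1 < n2)%N -> (n2 < n3)%N -> (n3 <= j)%N -> x n1 \in u ->
    x n2 \in u -> x n3 \in u -> o n1 n2 n3 <> 0.
  move=> l12 l23 l3; rewrite uE => /tri_vertex h1 /tri_vertex h2 /tri_vertex h3.
  have {}h1 := h1 ltac:(nlia) ltac:(nlia) ltac:(nlia) ltac:(nlia).
  have {}h2 := h2 ltac:(nlia) ltac:(nlia) ltac:(nlia) ltac:(nlia).
  have {}h3 := h3 ltac:(nlia) ltac:(nlia) ltac:(nlia) ltac:(nlia).
  have [-> -> ->] : [/\ n1 = a, n2 = b & n3 = c].
    by case: h1; case: h2; case: h3 => ? ? ?; split; nlia.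
  by move=> e; rewrite e ltxx in o0.
(* A point x_c past x_q would lie on the closing side, inside the edge from x_q to x_i. *)
have cq : (c <= q)%N.
  rewrite leqNgt; apply/negP => qc.
  have e : o i q c = 0 by apply/eqP; rewrite (chain_orient_eq0 P) ?eqxx/= ?orbT; nlia.
  suff : [\/ c = i, c = k | c = q] by case; nlia.
  apply: vin; [nlia|done|by apply: chain_orient_ge0; nlia|by apply: chain_orient_ge0; nlia|].
  by rewrite orient_rot orient_swap e oppr0.
(* In the collinear case x_n would lie on the edge x_i x_k without being one of the three vertices;
   [claimR] is the analogue for x_k x_q. *)
have claimL n : (i < n < k)%N -> x n \in u -> 0 < o i n k.
  move=> hn nu; rewrite lt_neqAle chain_orient_ge0 ?andbT; [|nlia..].
  apply/eqP => e; suff : [\/ n = i, n = k | n = q] by case; nlia.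
  apply: vin; [nlia|done|by rewrite orient_swap -e oppr0|..].
    by rewrite -orient_rot; apply: chain_orient_ge0; nlia.
  by rewrite orient_rot; apply: chain_orient_ge0; nlia.
have claimR n : (k < n < q)%N -> x n \in u -> 0 < o k n q.
  move=> hn nu; rewrite lt_neqAle chain_orient_ge0 ?andbT; [|nlia..].
  apply/eqP => e; suff : [\/ n = i, n = k | n = q] by case; nlia.
  apply: vin; [nlia|done|by apply: chain_orient_ge0; nlia|by rewrite orient_swap -e oppr0|].
  by rewrite orient_rot; apply: chain_orient_ge0; nlia.
have nSL n : (i < n < k)%N -> x n \in u -> ~~ S i k.
  move=> hn nu; apply: contraTN (claimL n hn nu) => Sik.
  suff /eqP -> : o i n k == 0 by rewrite ltxx.
  by rewrite (chain_orient_eq0 P) ?Sik//; nlia.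
have nSR n : (k < n < q)%N -> x n \in u -> ~~ S k q.
  move=> hn nu; apply: contraTN (claimR n hn nu) => Skq.
  suff /eqP -> : o k n q == 0 by rewrite ltxx.
  by rewrite (chain_orient_eq0 P) ?Skq//; nlia.
(* The segment from x_m' to x_n would cross the interior of the triangle
   x_i x_k x_q, or contain one of its vertices. *)
have nopair m' n : (i <= m' < k)%N -> (k < n <= q)%N -> (m' != i) || (n != q) ->
    x m' \in u -> x n \in u -> False.
  move=> hm hn hmn mu nu.
  have sub2 : {subset [fset x m'; x n]%fset <= u}.
    by move=> z; rewrite in_fset2 => /orP[] /eqP ->.
  (* Collinear case: x_k lies on the segment, hence is a vertex of u, which then has three collinear
     vertices. *)
  have [e|] := eqVneq (o m' k n) 0.
    have : hull u (x k).
      apply: (hull_mono sub2); have [mi|mi] := eqVneq m' i.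
        have nq : n != q by rewrite mi eqxx in hmn.
        apply: (@collinear_between _ (x q)) => //.
        - by rewrite orient_rot; apply: chain_orient_ge0; nlia.
        - by rewrite orient_rot; apply: chain_orient_ge0; nlia.
        rewrite orient_rot; apply: (chain_orient_gt0 P); try nlia.
          by apply: off_side_widen nS; nlia.
        rewrite mi eqxx /= -ltnNge; move/eqP: e.
        rewrite (chain_orient_eq0 P)//; try nlia; rewrite mi => /orP[Sin|]; last nlia.
        by rewrite ltnNge; apply: contra nS => Bn; apply: S_sub Sin.
      apply: (@collinear_between _ (x i)) => //.
      - by apply: chain_orient_ge0; nlia.
      - by apply: chain_orient_ge0; nlia.
      apply: (chain_orient_gt0 P) => //; try nlia.
      by apply: off_side_widen (nSL m' _ mu); nlia.
    move=> /(win k) ku; apply: (udeg m' k n) => //; try nlia.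
    by apply: ku; constructor 2.
  move=> n0; have {n0} omkn : 0 < o m' k n.
    by rewrite lt_neqAle eq_sym n0 chain_orient_ge0//; nlia.
  (* Here the segment runs along the closing side and contains x_q, which makes u degenerate
     again. *)
  have [/andP[/eqP mi Bn]|hB] := boolP ((m' == i) && (B <= n)%N).
    have nq : n != q by rewrite mi eqxx in hmn.
    have e : o i n q = 0 by apply/eqP; rewrite (chain_orient_eq0 P) ?eqxx/= ?Bn ?orbT; nlia.
    have : hull u (x q).
      apply: (@hull_mono _ [fset x n; x i]%fset).
        by move=> z; rewrite in_fset2 => /orP[] /eqP -> //; rewrite -mi.
      apply: (@collinear_between _ (x k)).
      - by rewrite -orient_rot.
      - by apply: chain_orient_ge0; nlia.
      - by rewrite -orient_rot ltW.
      - by rewrite -orient_rot -mi.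
    move=> /(win q) qu; apply: (udeg i n q) => //; try nlia; first by rewrite -mi.
    by apply: qu; constructor 3.
  have fn : 0 < o i k n.
    have [<-//|mi] := eqVneq m' i; apply: (chain_orient_gt0 P) => //; try nlia.
    by apply: off_side_widen (nSL m' _ mu); nlia.
  have gm : 0 < o k q m'.
    rewrite -orient_rot; have [->//|mi] := eqVneq m' i.
    have [<-//|nq] := eqVneq n q; apply: (chain_orient_gt0 P) => //; try nlia.
    by apply: off_side_widen (nSR n _ nu); nlia.
  have fm : o i k m' <= 0 by rewrite orient_swap oppr_le0; apply: chain_orient_ge0; nlia.
  have gn : o k q n <= 0 by rewrite orient_swap oppr_le0; apply: chain_orient_ge0; nlia.
  have hm0 : 0 <= o q i m' by rewrite orient_rot; apply: chain_orient_ge0; nlia.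
  have hn0 : 0 <= o q i n by rewrite orient_rot; apply: chain_orient_ge0; nlia.
  have id : o i k n * o k q m' - o i k m' * o k q n = o m' k n * o i k q.
    by rewrite !orientE; ring.
  have e1 : (o i k n - o k q n) * o i k m' + (o k q m' - o i k m') * o i k n =
      o m' k n * o i k q by rewrite -id; ring.
  have e2 : (o i k n - o k q n) * o k q m' + (o k q m' - o i k m') * o k q n =
      o m' k n * o i k q by rewrite -id; ring.
  have idp : 0 < o m' k n * o i k q by rewrite mulr_gt0.
  (* With these weights the two edge functionals take the same value. *)
  pose al := o i k n - o k q n; pose be := o k q m' - o i k m'.
  have al0 : 0 < al by rewrite /al; lra.
  have be0 : 0 < be by rewrite /be; lra.
  have hh : 0 < al * o q i m' + be * o q i n.
    have [mi|mi] := eqVneq m' i.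
      have : 0 < o q i n.
        rewrite orient_rot; apply: (chain_orient_gt0 P); try nlia.
        by apply: off_side_widen nS; nlia.
      by move=> h; rewrite ltr_wpDl ?mulr_gt0// mulr_ge0 ?(ltW al0).
    have : 0 < o q i m'.
      rewrite orient_rot; apply: (chain_orient_gt0 P); try nlia.
      by apply: off_side_widen nS; nlia.
    by move=> h; rewrite ltr_wpDr ?mulr_gt0// mulr_ge0 ?(ltW be0).
  have ab0 : 0 < al + be by rewrite addr_gt0.
  pose s := be / (al + be).
  have E p r : orient p r ((1 - s) *: x m' + s *: x n) =
      (al * orient p r (x m') + be * orient p r (x n)) / (al + be).
    by rewrite orient_conv /s; field; rewrite gt_eqF.
  have s01 : 0 <= s <= 1.
    by rewrite divr_ge0 ?(ltW be0) ?(ltW ab0)//= ler_pdivrMr// mul1r lerDr ltW.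
  apply: (@meet_properly_inner _ (x i) (x k) (x q) u ((1 - s) *: x m' + s *: x n)) => //.
  - by rewrite E e1 divr_gt0.
  - by rewrite E e2 divr_gt0.
  - by rewrite E divr_gt0.
  - by apply: hull_conv => //; apply: hull_in.
have subs i' j' : (i' <= a)%N -> (c <= j')%N -> (u `<=` chain i' j')%fset.
  move=> h1 h2; apply/fsubsetP => z; rewrite uE !inE -orbA => /or3P[] /eqP ->;
  apply: chain_in; nlia.
have [ck|kc] := leqP c k; first by rewrite subs.
have [ka|ak] := leqP k a; first by rewrite (subs k q) ?orbT.
exfalso; have [ai|ai] := eqVneq a i; last by apply: (nopair a c) => //; try nlia; rewrite ai.
have [cE|cE] := eqVneq c q; last by apply: (nopair a c) => //; try nlia; rewrite cE orbT.
have [bk|bk|bk] := ltngtP b k.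
- by apply: (nopair b c) => //; nlia.
- by apply: (nopair a b) => //; nlia.
- by move: une; rewrite uE ai bk cE eqxx.
Qed.

(** * Cutting along the base triangle, and gluing *)

(** A point on the line p r may be covered in T by triangles of the other side. Moved slightly
    towards x_n, it leaves that line, so only triangles of the subchain cover it; [cover_limit]
    brings it back. *)
Lemma restrict_triangulation T i j i' j' p r n : (j < N)%N ->
  (i <= i')%N -> (j' <= j)%N -> (i' <= n <= j')%N ->
  triangulation (chain i j) T -> orient p r (x n) < 0 ->
  {in chain i' j', forall z, orient p r z <= 0} ->
  (forall u, u \in T -> ~~ (u `<=` chain i' j')%fset -> {in u, forall z, 0 <= orient p r z}) ->
  triangulation (chain i' j') [fset u in T | (u `<=` chain i' j')%fset]%fset.
Proof.
move=> jN ii jj hn [Ttri Tcov Tmeet] zn cneg upos.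
have mem u : u \in [fset u in T | (u `<=` chain i' j')%fset]%fset =
    (u \in T) && (u `<=` chain i' j')%fset by rewrite !inE.
split.
- by move=> u; rewrite mem => /andP[/Ttri[? _] ?].
- apply/seteqP; split=> [y [u /=]|y hy].
    by rewrite mem => /andP[_ /fsubsetP sub]; apply: hull_mono.
  have [||u] := @cover_limit _ [fset u in T | (u `<=` chain i' j')%fset]%fset y (x n).
  + move=> u; rewrite mem => /andP[uT us]; have [ut _] := Ttri _ uT.
    have j'N : (j' < N)%N by nlia.
    have [a [b [c [_ _ _ _ [-> o0]]]]] := chain_triangle j'N ut us.
    by exists (x a), (x b), (x c).
  + move=> e /andP[e0 e1].
    have hyn : hull (chain i' j') ((1 - e) *: y + e *: x n).
      by apply: hull_conv; rewrite ?e1 ?(ltW e0)//; apply: hull_in; apply: chain_in.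
    have : hull (chain i j) ((1 - e) *: y + e *: x n).
      by move: hyn; apply: hull_mono; apply: chain_sub.
    rewrite -Tcov => -[u /= uT hu]; exists u => //; rewrite mem uT /=.
    apply: contraT => nsub; have := hull_ge0 (upos _ uT nsub) hu.
    have : 0 <= orient r p y.
      by apply: hull_ge0 hy => z zc; rewrite orient_flip oppr_ge0 cneg.
    rewrite orient_flip oppr_ge0 orient_conv => h1.
    have h2 : (1 - e) * orient p r y <= 0 by rewrite mulr_ge0_le0// subr_ge0.
    have h3 : e * orient p r (x n) < 0 by rewrite pmulr_rlt0.
    lra.
  + by move=> uT hu; exists u.
- by move=> u v; rewrite !mem => /andP[uT _] /andP[vT _]; apply: Tmeet.
Qed.

Lemma polygon_left i j B k : polygon i j B -> (i < k < B)%N -> ~~ S i k -> polygon i k k.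
Proof.
by case=> iB Bj jN hB nS hk nSk; split => //; try nlia; left; split => //; nlia.
Qed.

Lemma polygon_right i j B k q : polygon i j B -> (i < k < B)%N -> (B <= q <= j)%N ->
  ~~ S k q -> polygon k q q.
Proof.
by case=> iB Bj jN hB nS hk hq nSk; split => //; try nlia; left; split => //; nlia.
Qed.

Definition join_triangulations (i k q : nat) (T1 T2 : {fset {fset plane}}) : {fset {fset plane}} :=
  (tri i k q |` (T1 `|` T2))%fset.

Lemma collinear_no_triangle i j B i' k' u : polygon i j B -> (i <= i')%N -> (k' <= j)%N ->
  S i' k' -> is_triangle u -> ~~ (u `<=` chain i' k')%fset.
Proof.
move=> P ii kj Sik ut; have [iB Bj jN _ nS] := P; apply/negP => us.
have k'N : (k' < N)%N by nlia.
have [a [b [c [ia ab bc ck [_ o0]]]]] := chain_triangle k'N ut us.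
suff e : o a b c == 0 by rewrite (eqP e) ltxx in o0.
by rewrite (chain_orient_eq0 P); try nlia; rewrite (S_sub ia ck Sik).
Qed.

Lemma chain_triangulation_sub i j B i' k' T : polygon i j B -> (i <= i')%N -> (k' <= j)%N ->
  chain_triangulation i' k' T ->
  forall u, u \in T -> [/\ is_triangle u, (u `<=` chain i' k')%fset & ~~ S i' k'].
Proof.
move=> P ii kj; rewrite /chain_triangulation.
case: ifP => [_ ->|/negbT Sik [h _ _] u uT]; first by [].
by have [h1 h2] := h u uT.
Qed.

Lemma apex_gt0 i j B k q : polygon i j B -> (i < k < B)%N -> (B <= q <= j)%N ->
  0 < o i k q.
Proof.
move=> P hk hq; apply: (chain_orient_gt0 P); try nlia.
by apply: off_side_widen (pg_nS P); nlia.
Qed.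

Lemma apex_is_triangle i j B k q : polygon i j B -> (i < k < B)%N -> (B <= q <= j)%N ->
  is_triangle (tri i k q).
Proof. by move=> P hk hq; exists (x i), (x k), (x q); rewrite gt_eqF// (apex_gt0 P hk hq). Qed.

Lemma left_le0 i j B k q : polygon i j B -> (i < k < B)%N -> (B <= q <= j)%N ->
  {in chain i k, forall z, orient (x i) (x k) z <= 0}.
Proof.
move=> P hk hq _ /chainP[c hc ->]; have jN := pg_jN P.
by rewrite orient_swap oppr_le0 chain_orient_ge0//; nlia.
Qed.

Lemma left_ge0 i j B k q : polygon i j B -> (i < k < B)%N -> (B <= q <= j)%N ->
  {in chain k q, forall z, 0 <= orient (x i) (x k) z}.
Proof.
move=> P hk hq _ /chainP[c hc ->]; have jN := pg_jN P.
by rewrite chain_orient_ge0//; nlia.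
Qed.

Lemma right_le0 i j B k q : polygon i j B -> (i < k < B)%N -> (B <= q <= j)%N ->
  {in chain k q, forall z, orient (x k) (x q) z <= 0}.
Proof.
move=> P hk hq _ /chainP[c hc ->]; have jN := pg_jN P.
by rewrite orient_swap oppr_le0 chain_orient_ge0//; nlia.
Qed.

Lemma right_ge0 i j B k q : polygon i j B -> (i < k < B)%N -> (B <= q <= j)%N ->
  {in chain i k, forall z, 0 <= orient (x k) (x q) z}.
Proof.
move=> P hk hq _ /chainP[c hc ->]; have jN := pg_jN P.
by rewrite -orient_rot chain_orient_ge0//; nlia.
Qed.

Lemma triangulation_split i j B k q T : polygon i j B -> (i < k < B)%N -> (B <= q <= j)%N ->
  triangulation (chain i j) T -> tri i k q \in T ->
  [/\ chain_triangulation i k [fset u in T | (u `<=` chain i k)%fset]%fset,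
      chain_triangulation k q [fset u in T | (u `<=` chain k q)%fset]%fset &
      T = join_triangulations i k q [fset u in T | (u `<=` chain i k)%fset]%fset
                     [fset u in T | (u `<=` chain k q)%fset]%fset].
Proof.
move=> P hk hq HT tT; have jN := pg_jN P; have [Ttri Tcov Tmeet] := HT.
have split u : u \in T -> u != tri i k q ->
    (u `<=` chain i k)%fset || (u `<=` chain k q)%fset.
  move=> uT ut; have [u1 u2] := Ttri u uT.
  apply: (split_triangle P hk hq u1 u2) => //.
  by apply: Tmeet => //; rewrite eq_sym.
split.
- rewrite /chain_triangulation; case: ifPn => Sik.
    apply/fsetP => u; rewrite !inE /=; apply/negP => /andP[uT us].
    have [ut _] := Ttri u uT; move: us; apply/negP.
    by apply: (collinear_no_triangle P) => //; nlia.
  have ik : i.+1 != k.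
    by apply: contraNneq Sik => <-; apply: S_succ; nlia.
  (* The neighbour x_(i+1) is strictly off the chord x_i x_k, because x_i and x_k are on no common
     side. *)
  apply: (restrict_triangulation (p := x i) (r := x k) (n := i.+1) jN _ _ _ HT); try nlia.
  + rewrite orient_swap oppr_lt0; apply: (chain_orient_gt0 P) => //; nlia.
  + exact: (left_le0 P hk hq).
  + move=> u uT nsub; have [->|un] := eqVneq u (tri i k q).
      move=> z; rewrite !inE -orbA => /or3P[] /eqP ->;
      by rewrite ?orient_ids ?orient_idr ?(ltW (apex_gt0 P hk hq)).
    have := split u uT un; rewrite (negPf nsub) /= => /fsubsetP us z /us.
    exact: (left_ge0 P hk hq).
- rewrite /chain_triangulation; case: ifPn => Skq.
    apply/fsetP => u; rewrite !inE /=; apply/negP => /andP[uT us].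
    have [ut _] := Ttri u uT; move: us; apply/negP.
    by apply: (collinear_no_triangle P) => //; nlia.
  have ik : k.+1 != q.
    by apply: contraNneq Skq => <-; apply: S_succ; nlia.
  apply: (restrict_triangulation (p := x k) (r := x q) (n := k.+1) jN _ _ _ HT); try nlia.
  + rewrite orient_swap oppr_lt0; apply: (chain_orient_gt0 P) => //; nlia.
  + exact: (right_le0 P hk hq).
  + move=> u uT nsub; have [->|un] := eqVneq u (tri i k q).
      move=> z; rewrite !inE -orbA => /or3P[] /eqP ->;
      by rewrite ?orient_ids ?orient_idr // -orient_rot ltW ?(apex_gt0 P hk hq).
    have := split u uT un; rewrite (negPf nsub) orbF => /fsubsetP us z /us.
    exact: (right_ge0 P hk hq).
- apply/fsetP => u; rewrite !inE /=; have [->|un] := eqVneq u (tri i k q) => //=.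
  by have [uT|//] := boolP (u \in T); rewrite split.
Qed.

(** The signs along x_i x_k and x_k x_q decide which of the three pieces covers a point, and the
    same lines separate triangles of different pieces. A chain that carries triangles is not inside
    a side, hence meets its chord at the two ends only. *)
Lemma join_triangulation i j B k q T1 T2 : polygon i j B -> (i < k < B)%N -> (B <= q <= j)%N ->
  chain_triangulation i k T1 -> chain_triangulation k q T2 ->
  triangulation (chain i j) (join_triangulations i k q T1 T2).
Proof.
move=> P hk hq H1 H2; have [iB Bj jN _ nS] := P.
have [ik kj qj] : [/\ i <= k, k <= j & q <= j]%N by split; nlia.
have s1 := chain_triangulation_sub P (leqnn i) kj H1.
have s2 := chain_triangulation_sub P ik qj H2.
have subl : {subset chain i k <= chain i j} by apply: chain_sub; nlia.
have subr : {subset chain k q <= chain i j} by apply: chain_sub; nlia.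
have ts : {subset tri i k q <= chain i j}.
  by move=> z; rewrite !inE -orbA => /or3P[] /eqP ->; apply: chain_in; nlia.
have xneq a b : (i <= a)%N -> (a < b)%N -> (b <= j)%N -> x a != x b.
  move=> ia ab bj; apply/eqP => /x_inj e.
  by have := e ltac:(rewrite inE; nlia) ltac:(rewrite inE; nlia); nlia.
have zero_l u : u \in T1 ->
    {in u, forall z, orient (x i) (x k) z = 0 -> z \in [fset x i; x k]%fset}.
  move=> /s1[_ /fsubsetP us nS1] z /us /chainP[c hc ->] e.
  have [->|ci] := eqVneq c i; first by rewrite !inE eqxx.
  have [->|ck] := eqVneq c k; first by rewrite !inE eqxx orbT.
  suff : 0 < o i c k by rewrite orient_swap e oppr0 ltxx.
  by apply: (chain_orient_gt0 P) => //; nlia.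
have zero_r u : u \in T2 ->
    {in u, forall z, orient (x k) (x q) z = 0 -> z \in [fset x k; x q]%fset}.
  move=> /s2[_ /fsubsetP us nS1] z /us /chainP[c hc ->] e.
  have [->|ci] := eqVneq c k; first by rewrite !inE eqxx.
  have [->|ck] := eqVneq c q; first by rewrite !inE eqxx orbT.
  suff : 0 < o k c q by rewrite orient_swap e oppr0 ltxx.
  by apply: (chain_orient_gt0 P) => //; nlia.
have m1 u : u \in T1 -> meet_properly (tri i k q) u.
  move=> uT; have [_ /fsubsetP us nS1] := s1 u uT.
  apply: (@meet_properly_separated _ (x i) (x k)).
  - by apply: xneq; nlia.
  - move=> z; rewrite !inE -orbA => /or3P[] /eqP ->;
    by rewrite ?orient_ids ?orient_idr ?(ltW (apex_gt0 P hk hq)).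
  - by move=> z /us; apply: (left_le0 P hk hq).
  - move=> z; rewrite !inE -orbA => /or3P[] /eqP ->; rewrite ?eqxx ?orbT//.
    by move=> e; have := (apex_gt0 P hk hq); rewrite e ltxx.
  - exact: zero_l.
have m2 u : u \in T2 -> meet_properly (tri i k q) u.
  move=> uT; have [_ /fsubsetP us nS1] := s2 u uT.
  apply: (@meet_properly_separated _ (x k) (x q)).
  - by apply: xneq; nlia.
  - move=> z; rewrite !inE -orbA => /or3P[] /eqP ->;
    by rewrite ?orient_ids ?orient_idr // -orient_rot ltW ?(apex_gt0 P hk hq).
  - by move=> z /us; apply: (right_le0 P hk hq).
  - move=> z; rewrite !inE -orbA => /or3P[] /eqP ->; rewrite ?eqxx ?orbT//.
    by rewrite -orient_rot => e; have := (apex_gt0 P hk hq); rewrite e ltxx.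
  - exact: zero_r.
have m12 u v : u \in T1 -> v \in T2 -> meet_properly v u.
  move=> uT vT; have [_ /fsubsetP us nS1] := s1 u uT.
  have [_ /fsubsetP vs nS2] := s2 v vT.
  apply: (@meet_properly_separated _ (x i) (x k)).
  - by apply: xneq; nlia.
  - by move=> z /vs; apply: (left_ge0 P hk hq).
  - by move=> z /us; apply: (left_le0 P hk hq).
  - move=> z /vs /chainP[c hc ->] /eqP e; rewrite !inE.
    have [->|ck] := eqVneq c k; first by rewrite eqxx orbT.
    move: e; rewrite (chain_orient_eq0 P); try nlia.
    have -> : (B <= k)%N = false by nlia.
    rewrite andbF orbF => Sic; exfalso; move: nS1; apply/negP; rewrite negbK.
    by apply: S_sub Sic; nlia.
  - exact: zero_l.
split.
- move=> u; rewrite !inE => /or3P[/eqP ->|/s1[h1 h2 _]|/s2[h1 h2 _]]; split => //.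
  + exact: (apex_is_triangle P hk hq).
  + exact/fsubsetP.
  + by apply/fsubsetP => z /(fsubsetP h2) /subl.
  + by apply/fsubsetP => z /(fsubsetP h2) /subr.
- apply/seteqP; split=> [y [u /=]|y hy].
    rewrite !inE => /or3P[/eqP ->|/s1[_ /fsubsetP h2 _]|/s2[_ /fsubsetP h2 _]];
      apply: hull_mono => // z /h2; [exact: subl|exact: subr].
  have [y1 y2] := (hull_chainP y P).1 hy.
  have [f0|f0] := ltP (orient (x i) (x k) y) 0.
    (* If the chain were inside a side, x_i x_k would support the polygon, leaving no point strictly
       to its right. *)
    have nSik : ~~ S i k.
      apply: contraTN f0 => Sik; rewrite -leNgt; apply: hull_ge0 hy => _ /chainP[c hc ->].
      have [kc|ck] := leqP k c; first by apply: chain_orient_ge0; nlia.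
      rewrite orient_swap; have [->|ci] := eqVneq c i; first by rewrite orient_idl oppr0.
      suff /eqP -> : o i c k == 0 by rewrite oppr0.
      by rewrite (chain_orient_eq0 P) ?Sik//; nlia.
    move: H1; rewrite /chain_triangulation (negPf nSik) => -[_ cov _].
    have : hull (chain i k) y.
      apply/(hull_chainP _ (polygon_left P hk nSik)); split=> [a ha|].
        by apply: y1; nlia.
      by rewrite orient_flip oppr_ge0 ltW.
    by rewrite -cov => -[u /= uT hu]; exists u; rewrite //= !inE uT orbT.
  have [g0|g0] := ltP (orient (x k) (x q) y) 0.
    have nSkq : ~~ S k q.
      apply: contraTN g0 => Skq; rewrite -leNgt; apply: hull_ge0 hy => _ /chainP[c hc ->].
      have [qc|cq] := leqP q c; first by apply: chain_orient_ge0; nlia.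
      have [ck|kc] := leqP c k; first by rewrite -orient_rot; apply: chain_orient_ge0; nlia.
      rewrite orient_swap; suff /eqP -> : o k c q == 0 by rewrite oppr0.
      by rewrite (chain_orient_eq0 P) ?Skq//; nlia.
    move: H2; rewrite /chain_triangulation (negPf nSkq) => -[_ cov _].
    have : hull (chain k q) y.
      apply/(hull_chainP _ (polygon_right P hk hq nSkq)); split=> [a ha|].
        by apply: y1; nlia.
      by rewrite orient_flip oppr_ge0 ltW.
    by rewrite -cov => -[u /= uT hu]; exists u; rewrite //= !inE uT !orbT.
  exists (tri i k q); rewrite /= ?inE ?eqxx//.
  apply/triangleP; [exact: (apex_gt0 P hk hq)|split => //].
  (* The third inequality holds on the whole polygon: the points past x_q are on the line x_i
     x_q. *)
  apply: hull_ge0 hy => _ /chainP[c hc ->]; rewrite orient_rot.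
  have [cq|qc] := leqP c q; first by apply: chain_orient_ge0; nlia.
  rewrite orient_swap; suff /eqP -> : o i q c == 0 by rewrite oppr0.
  by rewrite (chain_orient_eq0 P) ?eqxx /=; [rewrite (_ : (B <= q)%N) ?orbT//; nlia|nlia..].
- move=> u v; rewrite !inE.
  case/or3P => [/eqP ->|uT|uT]; case/or3P => [/eqP ->|vT|vT] uv.
  + by rewrite eqxx in uv.
  + exact: m1.
  + exact: m2.
  + exact/meet_properly_sym/m1.
  + move: H1; rewrite /chain_triangulation; case: ifP => [_ T0|_ [_ _]]; last exact.
    by rewrite T0 in uT.
  + exact/meet_properly_sym/m12.
  + exact/meet_properly_sym/m2.
  + exact: m12.
  + move: H2; rewrite /chain_triangulation; case: ifP => [_ T0|_ [_ _]]; last exact.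
    by rewrite T0 in uT.
Qed.

(** * Summation over triangulations and the number of used points *)

Definition triangulations (C : {fset plane}) : {fset {fset {fset plane}}} :=
  [fset T in fpowerset (fpowerset C) | `[< triangulation C T >]]%fset.

Definition chain_triangulations i j : {fset {fset {fset plane}}} :=
  [fset T in fpowerset (fpowerset (chain i j)) | `[< chain_triangulation i j T >]]%fset.

Lemma triangulation_sub (C : {fset plane}) T : triangulation C T ->
  T \in fpowerset (fpowerset C).
Proof.
move=> [h _ _]; rewrite fpowersetE; apply/fsubsetP => t /h[_ tC].
by rewrite fpowersetE.
Qed.

Lemma triangulationsP C T : reflect (triangulation C T) (T \in triangulations C).
Proof.
rewrite !inE /=; apply: (iffP andP) => [[_ /asboolP]//|h].
by split; [exact: triangulation_sub|apply/asboolP].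
Qed.

Lemma chain_triangulationsP i j T :
  reflect (chain_triangulation i j T) (T \in chain_triangulations i j).
Proof.
rewrite !inE /=; apply: (iffP andP) => [[_ /asboolP]//|h].
split; last exact/asboolP.
move: h; rewrite /chain_triangulation; case: ifP => [_ ->|_ /triangulation_sub//].
by rewrite fpowersetE fsub0set.
Qed.

Lemma chain_triangulations_nS i j : ~~ S i j ->
  chain_triangulations i j = triangulations (chain i j).
Proof.
move=> nS; apply/fsetP => T; apply/chain_triangulationsP/triangulationsP;
by rewrite /chain_triangulation (negPf nS).
Qed.

Lemma chain_triangulations_S i j : S i j -> chain_triangulations i j = [fset fset0]%fset.
Proof.
move=> Sij; apply/fsetP => T; rewrite in_fset1; apply/chain_triangulationsP/eqP;
by rewrite /chain_triangulation Sij.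
Qed.

Lemma chain_mem i j n : (j < N)%N -> (n < N)%N -> (x n \in chain i j) = (i <= n <= j)%N.
Proof.
move=> jN nN; apply/chainP/idP => [[m hm /x_inj e]|h]; last by exists n.
by rewrite e// inE; nlia.
Qed.

Lemma chainI i k q p : (q < N)%N -> (i <= k)%N -> (k <= q)%N ->
  p \in chain i k -> p \in chain k q -> p = x k.
Proof.
move=> qN ik kq /chainP[a ha ->]; rewrite chain_mem; try nlia.
by move=> h; congr (x _); nlia.
Qed.

Lemma triangle_not_in_chainI i k q u : (q < N)%N -> (i <= k)%N -> (k <= q)%N ->
  is_triangle u -> (u `<=` chain i k)%fset -> ~~ (u `<=` chain k q)%fset.
Proof.
move=> qN ik kq [a [b [c [-> o0]]]] /fsubsetP h1; apply/negP => /fsubsetP h2.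
have h p : p \in [fset a; b; c]%fset -> p = x k.
  by move=> hp; apply: chainI (h1 _ hp) (h2 _ hp).
have ha := h a ltac:(by rewrite !inE eqxx).
have hb := h b ltac:(by rewrite !inE eqxx orbT).
by move: o0; rewrite ha hb orient_idl eqxx.
Qed.

Lemma join_left i j B k q T1 T2 : polygon i j B -> (i < k < B)%N -> (B <= q <= j)%N ->
  chain_triangulation i k T1 -> chain_triangulation k q T2 ->
  [fset u in join_triangulations i k q T1 T2 | (u `<=` chain i k)%fset]%fset = T1.
Proof.
move=> P hk hq H1 H2; have [iB Bj jN _ nS] := P.
have [ik kj qj] : [/\ i <= k, k <= j & q <= j]%N by split; nlia.
have s1 := chain_triangulation_sub P (leqnn i) kj H1.
have s2 := chain_triangulation_sub P ik qj H2.
apply/fsetP => u; rewrite !inE /=; apply/andP/idP => [[/or3P[/eqP ->|//|u2] us]|u1].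
- have := fsubsetP us (x q); rewrite !inE eqxx orbT => /(_ isT).
  by rewrite chain_mem; nlia.
- have [ut us2 _] := s2 u u2; have := triangle_not_in_chainI _ _ _ ut us.
  by move=> h; have := h q ltac:(nlia) ltac:(nlia) ltac:(nlia); rewrite us2.
- by have [_ -> _] := s1 u u1; rewrite u1 orbT.
Qed.

Lemma join_right i j B k q T1 T2 : polygon i j B -> (i < k < B)%N -> (B <= q <= j)%N ->
  chain_triangulation i k T1 -> chain_triangulation k q T2 ->
  [fset u in join_triangulations i k q T1 T2 | (u `<=` chain k q)%fset]%fset = T2.
Proof.
move=> P hk hq H1 H2; have [iB Bj jN _ nS] := P.
have [ik kj qj] : [/\ i <= k, k <= j & q <= j]%N by split; nlia.
have s1 := chain_triangulation_sub P (leqnn i) kj H1.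
have s2 := chain_triangulation_sub P ik qj H2.
apply/fsetP => u; rewrite !inE /=; apply/andP/idP => [[/or3P[/eqP ->|u1|//] us]|u2].
- have := fsubsetP us (x i); rewrite !inE eqxx => /(_ isT).
  by rewrite chain_mem; nlia.
- have [ut us1 _] := s1 u u1; have := triangle_not_in_chainI _ _ _ ut us1.
  by move=> h; have := h q ltac:(nlia) ltac:(nlia) ltac:(nlia); rewrite us.
- by have [_ -> _] := s2 u u2; rewrite u2 !orbT.
Qed.

(** Uniqueness of the base triangle: the triangles of T1 stop at x_k, so they miss x_q', and those
    of T2 start at x_k, so they miss x_i. *)
Lemma join_apex i j B k q k' q' T1 T2 : polygon i j B -> (i < k < B)%N -> (B <= q <= j)%N ->
  (i < k' < B)%N -> (B <= q' <= j)%N ->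
  chain_triangulation i k T1 -> chain_triangulation k q T2 ->
  tri i k' q' \in join_triangulations i k q T1 T2 -> k' = k /\ q' = q.
Proof.
move=> P hk hq hk' hq' H1 H2; have [iB Bj jN _ nS] := P.
have [ik kj qj] : [/\ i <= k, k <= j & q <= j]%N by split; nlia.
have s1 := chain_triangulation_sub P (leqnn i) kj H1.
have s2 := chain_triangulation_sub P ik qj H2.
rewrite !inE => /or3P[/eqP e|/s1[_ us _]|/s2[_ us _]].
- have vk : x k' \in tri i k q by rewrite -e !inE eqxx orbT.
  have vq : x q' \in tri i k q by rewrite -e !inE eqxx !orbT.
  have := tri_vertex _ _ _ _ vk; have := tri_vertex _ _ _ _ vq.
  move=> h1 h2; have {}h1 := h1 ltac:(nlia) ltac:(nlia) ltac:(nlia) ltac:(nlia).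
  have {}h2 := h2 ltac:(nlia) ltac:(nlia) ltac:(nlia) ltac:(nlia).
  by case: h1; case: h2 => ? ?; split; nlia.
- have := fsubsetP us (x q'); rewrite !inE eqxx !orbT => /(_ isT).
  by rewrite chain_mem; nlia.
- have := fsubsetP us (x i); rewrite !inE eqxx => /(_ isT).
  by rewrite chain_mem; nlia.
Qed.

(** Gluing is a bijection from the tuples (k, q, T1, T2): [base_triangle] and [triangulation_split]
    give surjectivity, while [join_apex] recovers k and q and restriction recovers T1 and T2. *)
Lemma sum_triangulations (V : nmodType) i j B (F : {fset {fset plane}} -> V) :
  polygon i j B ->
  \sum_(T <- triangulations (chain i j)) F T =
  \sum_(i.+1 <= k < B) \sum_(B <= q < j.+1)
    \sum_(T1 <- chain_triangulations i k) \sum_(T2 <- chain_triangulations k q)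
      F (join_triangulations i k q T1 T2).
Proof.
move=> P.
pose base := [seq (k, q) | k <- index_iota i.+1 B, q <- index_iota B j.+1].
pose pairs (d : nat * nat) := [seq (T1, T2) | T1 <- enum_fset (chain_triangulations i d.1),
   T2 <- enum_fset (chain_triangulations d.1 d.2)].
pose D := [seq (d, TT) | d <- base, TT <- pairs d].
pose f (e : (nat * nat) * ({fset {fset plane}} * {fset {fset plane}})) :=
  join_triangulations i e.1.1 e.1.2 e.2.1 e.2.2.
have memD e : e \in D -> [/\ (i < e.1.1 < B)%N, (B <= e.1.2 <= j)%N,
    chain_triangulation i e.1.1 e.2.1 & chain_triangulation e.1.1 e.1.2 e.2.2].
  move=> /allpairsPdep[d [TT [/allpairsP[[k q] [/= hk hq ->]]]]].
  move=> /allpairsP[[T1 T2] [/= /chain_triangulationsP h1 /chain_triangulationsP h2 ->] ->].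
  by split => //=; move: hk hq; rewrite !mem_index_iota ltnS.
transitivity (\sum_(T <- [seq f e | e <- D]) F T); last first.
  rewrite big_map big_allpairs_dep big_allpairs_dep; apply: eq_bigr => k _.
  by apply: eq_bigr => q _; rewrite big_allpairs_dep.
apply: perm_big; apply: uniq_perm.
- exact: fset_uniq.
- rewrite map_inj_in_uniq.
    apply: allpairs_uniq_dep.
    + apply: allpairs_uniq; rewrite ?iota_uniq//.
      by move=> [a b] [c d] _ _ [-> ->].
    + move=> d _; apply: allpairs_uniq; rewrite ?fset_uniq//.
      by move=> [a b] [c d'] _ _ [-> ->].
    + by move=> [a b] [c d] _ _ /= [-> ->].
  move=> [[k q] [T1 T2]] [[k' q'] [T1' T2']] /memD[/= hk hq H1 H2] /memD[/= hk' hq' H1' H2'].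
  rewrite /f /= => e.
  have [ek eq'] : k' = k /\ q' = q.
    by apply: (join_apex P hk hq hk' hq' H1 H2); rewrite e !inE eqxx.
  move: hk' hq' H1' H2' e; rewrite ek eq' => hk' hq' H1' H2' e; congr (_, _).
  have := join_left P hk hq H1 H2; have := join_right P hk hq H1 H2; rewrite e.
  by rewrite (join_left P hk hq H1' H2') (join_right P hk hq H1' H2') => -> ->.
- move=> T; apply/triangulationsP/mapP => [HT|[e /memD[hk hq H1 H2] ->]]; last first.
    exact: (join_triangulation P hk hq H1 H2).
  have [k [q [ik kB Bq qj tT]]] := base_triangle P HT.
  have hk : (i < k < B)%N by rewrite ik kB.
  have hq : (B <= q <= j)%N by rewrite Bq qj.
  have [H1 H2 E] := triangulation_split P hk hq HT tT.
  exists ((k, q), ([fset u in T | (u `<=` chain i k)%fset]%fset,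
                   [fset u in T | (u `<=` chain k q)%fset]%fset)); last exact: E.
  apply/allpairsPdep; exists (k, q), ([fset u in T | (u `<=` chain i k)%fset]%fset,
                   [fset u in T | (u `<=` chain k q)%fset]%fset); split => //.
    by apply/allpairsP; exists (k, q); rewrite /= !mem_index_iota ltnS.
  apply/allpairsP; exists ([fset u in T | (u `<=` chain i k)%fset]%fset,
                   [fset u in T | (u `<=` chain k q)%fset]%fset).
  by split => //=; apply/chain_triangulationsP.
Qed.

Lemma used_pointsP (T : {fset {fset plane}}) p :
  reflect (exists2 t, t \in T & p \in t) (p \in used_points T).
Proof.
apply: (iffP (bigfcupP _ _ _ _)) => -[t].
  by rewrite andbT => tT pt; exists t.
by move=> tT pt; exists t => //; rewrite tT.
Qed.

Lemma used_points_join i k q T1 T2 : used_points (join_triangulations i k q T1 T2) =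
  (tri i k q `|` (used_points T1 `|` used_points T2))%fset.
Proof.
apply/fsetP => p; rewrite in_fsetU [X in _ || X]in_fsetU; apply/used_pointsP/or3P.
  move=> [t tT pt]; move: tT; rewrite /join_triangulations in_fset1U in_fsetU => /or3P[/eqP tE|?|?].
  - by constructor 1; rewrite -tE.
  - by constructor 2; apply/used_pointsP; exists t.
  - by constructor 3; apply/used_pointsP; exists t.
case=> [pt|/used_pointsP[t tT pt]|/used_pointsP[t tT pt]].
- by exists (tri i k q); rewrite // !in_fsetU in_fset1 eqxx.
- by exists t; rewrite // !in_fsetU tT orbT.
- by exists t; rewrite // !in_fsetU tT !orbT.
Qed.

(* A chain contained in a side has no triangle, but its ends are used. *)
Definition used_with_ends i j (T : {fset {fset plane}}) : {fset plane} :=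
  (used_points T `|` [fset x i; x j])%fset.

(** The exponent omits one point because two glued chains share exactly x_k; this makes it additive.
    A chain inside a side uses its two ends and gives s. *)
Definition chain_poly i j : {poly int} :=
  \sum_(T <- chain_triangulations i j) 'X^(#|` used_with_ends i j T|.-1).

Lemma used_points_join_ends i k q T1 T2 : used_points (join_triangulations i k q T1 T2) =
  (used_with_ends i k T1 `|` used_with_ends k q T2)%fset.
Proof.
apply/fsetP => p; rewrite used_points_join /used_with_ends /tri.
rewrite !in_fsetU !in_fset1.
by case: (p \in used_points T1); case: (p \in used_points T2);
  case: (p == x i); case: (p == x k); case: (p == x q).
Qed.

Lemma card_used_points_join i j B k q T1 T2 : polygon i j B ->
  (i < k < B)%N -> (B <= q <= j)%N ->
  chain_triangulation i k T1 -> chain_triangulation k q T2 ->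
  #|` used_points (join_triangulations i k q T1 T2)| =
  (#|` used_with_ends i k T1|.-1 + #|` used_with_ends k q T2|.-1).+1%N.
Proof.
move=> P hk hq H1 H2; have [iB Bj jN _ nS] := P.
have [ik kj qj] : [/\ i <= k, k <= j & q <= j]%N by split; nlia.
have s1 := chain_triangulation_sub P (leqnn i) kj H1.
have s2 := chain_triangulation_sub P ik qj H2.
have u1 : {subset used_with_ends i k T1 <= chain i k}.
  move=> p; rewrite in_fsetU in_fset2.
  case/or3P => [/used_pointsP[t /s1[_ /fsubsetP ts _] /ts]//|/eqP ->|/eqP ->];
  apply: chain_in; nlia.
have u2 : {subset used_with_ends k q T2 <= chain k q}.
  move=> p; rewrite in_fsetU in_fset2.
  case/or3P => [/used_pointsP[t /s2[_ /fsubsetP ts _] /ts]//|/eqP ->|/eqP ->];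
  apply: chain_in; nlia.
have k1 : x k \in used_with_ends i k T1 by rewrite !inE eqxx !orbT.
have k2 : x k \in used_with_ends k q T2 by rewrite !inE eqxx !orbT.
have I : (used_with_ends i k T1 `&` used_with_ends k q T2 = [fset x k])%fset.
  apply/fsetP => p; rewrite in_fsetI in_fset1; apply/andP/eqP => [[p1 p2]|-> //].
  by apply: (chainI _ _ _ (u1 _ p1) (u2 _ p2)); nlia.
rewrite used_points_join_ends; have := cardfsUI (used_with_ends i k T1) (used_with_ends k q T2).
rewrite I cardfs1.
have : (0 < #|` used_with_ends i k T1|)%N by rewrite cardfs_gt0; apply/fset0Pn; exists (x k).
have : (0 < #|` used_with_ends k q T2|)%N by rewrite cardfs_gt0; apply/fset0Pn; exists (x k).
by move: #|` _|%N #|` _|%N #|` _|%N => a b c; nlia.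
Qed.

Lemma chain_poly_S i j : (i < j < N)%N -> S i j -> chain_poly i j = 'X.
Proof.
move=> ij Sij; rewrite /chain_poly chain_triangulations_S// big_seq_fset1.
have xne : x i != x j.
  have [iN jN ltij] : [/\ i < N, j < N & i < j]%N by split; nlia.
  by apply: contraTneq ltij => /x_inj e; rewrite e ?ltnn.
have -> : used_with_ends i j fset0 = [fset x i; x j]%fset.
  apply/fsetP => p; rewrite /used_with_ends in_fsetU.
  have [/used_pointsP[t]|//] := boolP (p \in used_points (fset0 : {fset {fset plane}})).
  by rewrite in_fset0.
by rewrite cardfs2 xne expr1.
Qed.

Lemma polygon_sum_used i j B : polygon i j B ->
  \sum_(T <- triangulations (chain i j)) 'X^(#|` used_points T|.-1) =
  \sum_(i.+1 <= k < B) \sum_(B <= q < j.+1) chain_poly i k * chain_poly k q.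
Proof.
move=> P; rewrite (sum_triangulations _ P).
apply: eq_big_nat => k hk.
apply: eq_big_nat => q hq.
rewrite /chain_poly mulr_suml; apply: eq_big_seq => T1 /chain_triangulationsP H1.
rewrite mulr_sumr; apply: eq_big_seq => T2 /chain_triangulationsP H2.
by rewrite (card_used_points_join P)//= exprD.
Qed.

(** With B = j the base triangle has x_i and x_j as vertices, so adding the ends changes nothing. *)
Lemma chain_poly_nS i j : polygon i j j ->
  chain_poly i j = \sum_(i.+1 <= k < j) chain_poly i k * chain_poly k j.
Proof.
move=> P; have [iB Bj jN _ nS] := P.
rewrite /chain_poly chain_triangulations_nS//.
transitivity (\sum_(T <- triangulations (chain i j)) 'X^(#|` used_points T|.-1) : {poly int}).
  apply: eq_big_seq => T /triangulationsP HT.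
  congr ('X^ (_.-1)); congr (#|` _|); apply/fsetP => p; rewrite in_fsetU in_fset2.
  have [//|pU] := boolP (p \in used_points T) => /=; apply/negP => h; case/negP: pU.
  have [k [q [ik kB Bq qj tT]]] := base_triangle P HT.
  apply/used_pointsP; exists (tri i k q) => //; have -> : q = j by nlia.
  by rewrite !inE; case/orP: h => ->; rewrite ?orbT.
rewrite (polygon_sum_used P); apply: eq_bigr => k _; by rewrite big_nat1.
Qed.

Lemma triangulation_poly_sum (C : {fset plane}) : triangulation_poly C =
  \sum_(T <- triangulations C) 'X^(#|` used_points T|).
Proof.
rewrite /triangulation_poly (eq_bigr (fun k : 'I_(#|` C|).+1 =>
   \sum_(T <- triangulations C | #|` used_points T| == k) 'X^k)); last first.
  move=> k _; rewrite big_const_seq iter_addr_0 /tau scaler_nat; congr (_ *+ _).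
  rewrite -size_filter; apply/perm_size/uniq_perm; rewrite ?filter_uniq ?fset_uniq// => T.
  by rewrite mem_filter !inE /= andbA andbC.
rewrite (exchange_big_dep xpredT)//=; apply: eq_big_seq => T.
move=> /triangulationsP[h _ _].
have lt : (#|` used_points T| < #|` C|.+1)%N.
  rewrite ltnS fsubset_leq_card//; apply/fsubsetP => p /used_pointsP[t /h[_ /fsubsetP]].
  by move=> tC /tC.
by rewrite (big_pred1 (Ordinal lt)).
Qed.

Lemma polygon_triangulation_poly i j B : polygon i j B ->
  triangulation_poly (chain i j) =
  'X * \sum_(i.+1 <= k < B) \sum_(B <= q < j.+1) chain_poly i k * chain_poly k q.
Proof.
move=> P; rewrite triangulation_poly_sum -(polygon_sum_used P) mulr_sumr.
apply: eq_big_seq => T /triangulationsP HT.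
rewrite -exprS prednK// cardfs_gt0; apply/fset0Pn.
have [k [q [_ _ _ _ tT]]] := base_triangle P HT.
by exists (x i); apply/used_pointsP; exists (tri i k q) => //; rewrite !inE eqxx.
Qed.

End Chain.

(** * The points of a weakly convex polygon *)

Section Extreme.
Variable R : realType.
Notation plane := 'rV[R]_2.
Implicit Types (p q x y : plane) (A B C : {fset plane}).

Lemma hull_hull A B : {in A, forall p, hull B p} -> hull A `<=` hull B.
Proof.
move=> AB x [w [w0 w1 ->]].
have [W HW] : {W : plane -> plane -> R & forall p, p \in A ->
    [/\ forall q, q \in B -> 0 <= W p q, \sum_(q <- B) W p q = 1
      & p = \sum_(q <- B) W p q *: q]}.
  apply: (@choice _ _ (fun p (Wp : plane -> R) => p \in A -> [/\ forall q, q \in B -> 0 <= Wp q,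
     \sum_(q <- B) Wp q = 1 & p = \sum_(q <- B) Wp q *: q])) => p.
  have [/AB[u hu]|_] := boolP (p \in A); first by exists u.
  by exists (fun=> 0).
exists (fun q => \sum_(p <- A) w p * W p q); split.
- move=> q qB; rewrite big_seq sumr_ge0// => p pA.
  by have [h _ _] := HW p pA; rewrite mulr_ge0 ?w0 ?h.
- rewrite exchange_big /= -w1; apply: eq_big_seq => p pA.
  by have [_ h _] := HW p pA; rewrite -mulr_sumr h mulr1.
- under [RHS]eq_bigr do rewrite scaler_suml.
  rewrite exchange_big /=; apply: eq_big_seq => p pA.
  have [_ _ pE] := HW p pA; rewrite [X in _ *: X = _]pE scaler_sumr; apply: eq_bigr => q _.
  by rewrite scalerA.
Qed.

Lemma hull_split A a x : a \in A -> hull A x -> x = a \/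
  exists t y, [/\ 0 <= t < 1, hull (A `\ a)%fset y & x = t *: a + (1 - t) *: y].
Proof.
move=> aA [w [w0 w1 xE]].
have wa0 := w0 a aA; rewrite (big_fsetD1 a) //= in w1; rewrite (big_fsetD1 a) //= in xE.
have wB p : p \in (A `\ a)%fset -> 0 <= w p by rewrite !inE => /andP[_ /w0].
set B := (A `\ a)%fset in w1 xE wB *.
have s0 : 0 <= \sum_(p <- B) w p by rewrite big_seq sumr_ge0// => p /wB.
have [e|ne] := eqVneq (w a) 1.
  left; have z : \sum_(p <- B) w p = 0 by lra.
  rewrite xE e scale1r big_seq big1 ?addr0// => p pB.
  have /eqP : w p = 0.
    apply/eqP; rewrite eq_le wB// andbT -z (big_fsetD1 p)//= lerDl big_seq sumr_ge0// => q.
    by rewrite in_fsetD1 => /andP[_ /wB].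
  by move=> /eqP ->; rewrite scale0r.
right; exists (w a), (\sum_(p <- B) (w p / (1 - w a)) *: p).
have n1 : 1 - w a != 0 by rewrite subr_eq0 eq_sym.
have lt1 : 0 < 1 - w a by rewrite lt_neqAle eq_sym n1; lra.
split.
- by rewrite wa0 /=; lra.
- exists (fun p => w p / (1 - w a)); split => //.
    by move=> p /wB h; rewrite divr_ge0// ltW.
  by rewrite -mulr_suml (_ : \sum_(p <- B) w p = 1 - w a) ?divff//; lra.
- rewrite xE scaler_sumr; congr (_ + _); apply: eq_bigr => p _.
  by rewrite scalerA mulrC divfK.
Qed.

(** Points of A are removed one by one; a point p of weight strictly between 0 and 1 in a
    combination equal to e must be e itself, by extremality. *)
Lemma extreme_in A C e : {subset A <= C} -> extreme_point (hull C) e -> hull A e -> e \in A.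
Proof.
move=> subAC [_ ext]; have [n le_n] := ubnP #|` A|; elim: n => // n IH in A subAC le_n *.
move=> he; have [A0|[p pA]] := fset_0Vmem A; first by rewrite A0 hull0 in he.
have [->//|[t [y [/andP[t0 t1] hy eE]]]] := hull_split pA he.
have BA : {subset (A `\ p)%fset <= A} by move=> q; rewrite !inE => /andP[].
have hyC : hull C y by apply: hull_mono hy => q /BA /subAC.
have [tz|tn] := eqVneq t 0.
  apply: (BA e); apply: IH => //.
  - by move=> q /BA /subAC.
  - by have := cardfsD1 p A; rewrite pA; lia.
  - by rewrite eE tz scale0r add0r subr0 scale1r.
have tp : 0 < t by rewrite lt_neqAle eq_sym tn.
have e2 := ext p y t (hull_in (subAC _ pA)) hyC tp t1 eE.
by rewrite eE -e2 -scalerDl addrC subrK scale1r.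
Qed.

(** Unless x = y = a, isolating the weight of a in x and in y and solving for a would express it
    through the other points. *)
Lemma not_hull_extreme A a x y (t : R) : a \in A -> ~ hull (A `\ a)%fset a ->
  hull A x -> hull A y -> 0 < t -> t < 1 -> a = t *: x + (1 - t) *: y -> x = y.
Proof.
move=> aA na hx hy t0 t1 aE.
have coord (k : 'I_2) : a 0 k = t * x 0 k + (1 - t) * y 0 k.
  by rewrite {1}aE !mxE.
have [xa|[al [x' [/andP[al0 al1] hx' xE]]]] := hull_split aA hx;
have [ya|[be [y' [/andP[be0 be1] hy' yE]]]] := hull_split aA hy.
- by rewrite xa ya.
- exfalso; apply: na; suff ay : a = y' by rewrite {2}ay.
  have c (k : 'I_2) : a 0 k = y' 0 k.
    have := coord k; rewrite xa yE !mxE => h.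
    have : (1 - t) * (1 - be) * (a 0 k - y' 0 k) = 0 by lra.
    move=> /eqP; rewrite !mulf_eq0 !subr_eq0 => /orP[/orP[/eqP|/eqP]|/eqP //]; lra.
  by apply: plane_eqP.
- exfalso; apply: na; suff ax : a = x' by rewrite {2}ax.
  have c (k : 'I_2) : a 0 k = x' 0 k.
    have := coord k; rewrite ya xE !mxE => h.
    have : t * (1 - al) * (a 0 k - x' 0 k) = 0 by lra.
    move=> /eqP; rewrite !mulf_eq0 !subr_eq0 => /orP[/orP[/eqP|/eqP]|/eqP //]; lra.
  by apply: plane_eqP.
- exfalso; apply: na.
  (* The total weight off a: c a = t (1 - al) x' + (1 - t) (1 - be) y'. *)
  set c := t * (1 - al) + (1 - t) * (1 - be).
  have p1 : 0 < t * (1 - al) by rewrite mulr_gt0// subr_gt0.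
  have p2 : 0 < (1 - t) * (1 - be) by rewrite mulr_gt0// subr_gt0.
  have c0 : 0 < c by rewrite addr_gt0.
  have aE' : a = (1 - (1 - t) * (1 - be) / c) *: x' + ((1 - t) * (1 - be) / c) *: y'.
    have e (k : 'I_2) : c * a 0 k = t * (1 - al) * x' 0 k + (1 - t) * (1 - be) * y' 0 k.
      have := coord k; rewrite xE yE !mxE /c => h; lra.
    have e2 : 1 - (1 - t) * (1 - be) / c = t * (1 - al) / c.
      by rewrite /c; field; rewrite -/c gt_eqF.
    have cc (k : 'I_2) : a 0 k = t * (1 - al) / c * x' 0 k + (1 - t) * (1 - be) / c * y' 0 k.
      apply: (@mulfI _ c); first by rewrite gt_eqF.
      by rewrite e; field; rewrite gt_eqF.
    by rewrite e2; apply: plane_eqP; rewrite !mxE cc.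
  rewrite {2}aE'; apply: hull_conv => //; rewrite divr_ge0 ?(ltW p2) ?(ltW c0)//=.
  by rewrite ler_pdivrMr// mul1r /c lerDr ltW.
Qed.

(* A minimal subset of C with the same hull consists of extremal points. *)
Lemma hull_extreme C : exists2 A, {in C, forall p, hull A p} &
  {in A, forall e, e \in C /\ extreme_point (hull C) e}.
Proof.
pose P A := {subset A <= C} /\ {in C, forall p, hull A p}.
have [A PA Amin] : exists2 A, P A & forall B, P B -> (#|` A| <= #|` B|)%N.
  have PC : exists n, `[< exists2 A, P A & #|` A| = n >].
    exists #|` C|; apply/asboolP; exists C => //; split=> // p; exact: hull_in.
  case: (ex_minnP PC) => n /asboolP[A PA An] mn; exists A => // B PB.
  by rewrite An; apply: mn; apply/asboolP; exists B.
have [subAC CA] := PA; exists A => // a aA; split; first exact: subAC.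
have CAs := hull_hull CA; split; first by apply: hull_in; apply: subAC.
move=> x y t hx hy; apply: (not_hull_extreme aA _ (CAs _ hx) (CAs _ hy)) => na.
have PB : P (A `\ a)%fset.
  split=> [q|q /CA]; first by rewrite !inE => /andP[_ /subAC].
  apply: hull_hull => p pA; have [->//|pa] := eqVneq p a.
  by apply: hull_in; rewrite !inE pa.
by have := Amin _ PB; have := cardfsD1 a A; rewrite aA; lia.
Qed.

Lemma orient_near p q x : 0 < orient p q x -> \forall y \near x, 0 < orient p q y.
Proof.
move=> o0; have H (a b : R) k :
    (fun y : 'rV[R]_2 => a * (y 0 k - b)) @ x --> a * (x 0 k - b).
  have c : (fun y : 'rV[R]_2 => y 0 k) @ x --> x 0 k by exact: coord_continuous.
  exact: (cvgM (cvg_cst a) (cvgB c (cvg_cst b))).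
have c : (fun y : 'rV[R]_2 => orient p q y) @ x --> orient p q x.
  rewrite orientE; under eq_fun do rewrite orientE.
  exact: (cvgB (H _ _ _) (H _ _ _)).
exact: (c _ (lt_nbhsr o0)).
Qed.

End Extreme.

(** The parameters of the points along the segment are sorted; the ends p and q have the extreme
    values 0 and 1. *)
Lemma segment_enum (R : realType) (F : {fset 'rV[R]_2}) p q m : p != q ->
  {in F, forall x, hull [fset p; q]%fset x} -> p \in F -> q \in F -> #|` F| = m.+1 ->
  exists lam : nat -> R, [/\ lam 0%N = 0, lam m = 1,
    forall c d, (c < d)%N -> (d <= m)%N -> lam c < lam d &
    forall x, x \in F <-> exists2 c, (c <= m)%N & x = (1 - lam c) *: p + lam c *: q].
Proof.
move=> pq Fh pF qF cF.
have [th Hth] : {th : 'rV[R]_2 -> R & forall x, x \in F ->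
    0 <= th x <= 1 /\ x = (1 - th x) *: p + th x *: q}.
  apply: (@choice _ _ (fun x (t : R) => x \in F -> 0 <= t <= 1 /\ x = (1 - t) *: p + t *: q)) => x.
  have [/Fh/hull2P[t ht]|_] := boolP (x \in F); first by exists t.
  by exists 0.
have inj t u : (1 - t) *: p + t *: q = (1 - u) *: p + u *: q -> t = u.
  move=> e; apply/eqP; rewrite -subr_eq0; apply: contraNT pq => tu.
  apply/eqP; apply: (scalerI tu); apply: plane_eqP.
    by have := congr1 (fun z : 'rV[R]_2 => z 0 0) e; rewrite !mxE; lra.
  by have := congr1 (fun z : 'rV[R]_2 => z 0 1) e; rewrite !mxE; lra.
pose s := sort <=%R [seq th x | x <- enum_fset F].
have us : uniq s.
  rewrite sort_uniq map_inj_in_uniq ?fset_uniq// => x y xF yF e.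
  by have [_ ->] := Hth x xF; have [_ ->] := Hth y yF; rewrite e.
have ss : size s = m.+1 by rewrite size_sort size_map -cF.
have lts : sorted <%R s by rewrite lt_sorted_uniq_le us sort_le_sorted.
have mem_s t : (t \in s) = (t \in [seq th x | x <- enum_fset F]) by rewrite mem_sort.
have th_p : th p = 0.
  by apply: inj; have [_ <-] := Hth p pF; rewrite subr0 scale1r scale0r addr0.
have th_q : th q = 1.
  by apply: inj; have [_ <-] := Hth q qF; rewrite subrr scale1r scale0r add0r.
have lt_nth c d : (c < d)%N -> (d <= m)%N -> nth 0 s c < nth 0 s d.
  by move=> cd dm; apply: (sorted_ltn_nth lt_trans) => //; rewrite inE ss; lia.
have in_s c : (c <= m)%N -> nth 0 s c \in s by move=> cm; rewrite mem_nth// ss.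
have bd t : t \in s -> 0 <= t <= 1.
  by rewrite mem_s => /mapP[x xF ->]; have [] := Hth x xF.
exists (nth 0 s); split => //.
- have : 0 \in s by rewrite mem_s -th_p; apply: map_f.
  move=> /(nthP 0)[c cs e]; have [/andP[h _]] := bd _ (in_s 0%N isT).
  rewrite ss in cs; case: c cs e => // c cs e; have := lt_nth 0%N c.+1 isT cs.
  by rewrite e; lra.
- have : 1 \in s by rewrite mem_s -th_q; apply: map_f.
  move=> /(nthP 0)[c cs e]; have /andP[_ h] := bd _ (in_s m (leqnn m)).
  have [<-//|cm] := eqVneq c m; have := lt_nth c m; rewrite e; rewrite ss in cs.
  by move=> /(_ ltac:(lia) ltac:(lia)); lra.
- move=> y; split=> [xF|[c cm ->]].
    have : th y \in s by rewrite mem_s map_f.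
    move=> /(nthP 0)[c cs e]; exists c; first by rewrite ss in cs.
    by rewrite e; have [] := Hth y xF.
  have : nth 0 s c \in s by exact: in_s.
  by rewrite mem_s => /mapP[x xF ->]; have [_ <-] := Hth x xF.
Qed.

(** * Points on the boundary of a convex polygon *)

Section ConvexPosition.
Variables (R : realType) (l : nat) (w : nat -> 'rV[R]_2).
Hypothesis l3 : (3 <= l)%N.
Hypothesis w_edge : forall i j, (i < l)%N -> (j < l)%N -> j != i ->
  j != (i.+1 %% l)%N -> 0 < orient (w i) (w i.+1) (w j).
Hypothesis w_close : w l = w 0%N.

Local Notation o a b c := (orient (w a) (w b) (w c)).

Lemma convex_edge_gt0 i j : (i.+1 < l)%N -> (j < l)%N -> j != i -> j != i.+1 -> 0 < o i i.+1 j.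
Proof. by move=> il jl ji ji1; apply: w_edge; rewrite ?modn_small// ltnW. Qed.

(** Induction on c: the Plucker relation at w a, with w (a + 1), w b, w c and w (c + 1), carries
    positivity from the edges to all increasing triples. *)
Lemma convex_fan_gt0 a b c : (a < b)%N -> (b < c)%N -> (c < l)%N -> 0 < o a b c.
Proof.
move=> ab; elim: c => // c IH; rewrite ltnS leq_eqVlt => /orP[/eqP <- bl|bc cl].
  by rewrite orient_rot; apply: convex_edge_gt0; lia.
have h1 := IH bc (ltnW cl).
have h2 : 0 < o a c c.+1 by rewrite orient_rot; apply: convex_edge_gt0; lia.
have e c' : (a.+1 < c')%N -> (c' < l)%N -> 0 < o a a.+1 c'.
  by move=> h h'; apply: convex_edge_gt0; lia.
have ec := e c ltac:(lia) ltac:(lia); have ec1 := e c.+1 ltac:(lia) cl.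
have eb : 0 <= o a a.+1 b.
  have [->|ba] := eqVneq b a.+1; first by rewrite orient_idr.
  by apply/ltW/e; lia.
have := orient_plucker (w a) (w a.+1) (w b) (w c) (w c.+1).
have p1 := mulr_ge0 eb (ltW h2); have p2 := mulr_gt0 ec1 h1.
move=> e0; rewrite -(pmulr_rgt0 _ ec); lra.
Qed.

Lemma convex_orient_gt0 a b c : (a < b)%N -> (b < c)%N -> (c <= l)%N -> (0 < a)%N || (c < l)%N ->
  0 < o a b c.
Proof.
move=> ab bc; rewrite leq_eqVlt => /orP[/eqP cl|cl _]; last exact: convex_fan_gt0.
rewrite cl in bc *; rewrite ltnn orbF => a0.
by rewrite w_close -orient_rot; apply: convex_fan_gt0 => //; lia.
Qed.

Lemma convex_orient_ge0 a b c : (a <= b)%N -> (b <= c)%N -> (c <= l)%N -> 0 <= o a b c.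
Proof.
rewrite leq_eqVlt => /orP[/eqP ->|ab]; first by rewrite orient_idl.
rewrite leq_eqVlt => /orP[/eqP ->|bc]; first by rewrite orient_idr.
move=> cl; have [h|] := boolP ((0 < a)%N || (c < l)%N); first exact/ltW/convex_orient_gt0.
rewrite negb_or => h; have [-> ->] : a = 0%N /\ c = l by lia.
by rewrite w_close orient_ids.
Qed.

(** The vertices alone form a chain whose sides join consecutive indices; taking A = l voids the
    clause about the last side. *)
Lemma hull_vertices (y : 'rV[R]_2) :
  (forall r, (r < l)%N -> 0 < orient (w r) (w r.+1) y) -> hull (chain w 0 l.-1) y.
Proof.
move=> hy; pose S a b := (b <= a.+1)%N.
have P : polygon l l S 0 l.-1 l.-1.
  by split; rewrite /S; try lia; left; split => //; right; lia.
apply/(@hull_chainP _ _ l l S _ _ _ _ 0 l.-1 l.-1 y) => //.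
- by move=> b _; rewrite /S.
- by move=> b c d e; rewrite /S; lia.
- by move=> a b c ab bc cl; rewrite ltW// convex_fan_gt0.
- move=> a b c ab bc cl; rewrite gt_eqF ?convex_fan_gt0// /S; lia.
split=> [a ha|]; first by apply/ltW/hy; lia.
have -> : w 0%N = w l.-1.+1 by rewrite prednK ?w_close//; lia.
by apply/ltW/hy; lia.
Qed.

Variables (N : nat) (a : nat -> nat) (side : nat -> nat) (lam : nat -> R) (x : nat -> 'rV[R]_2).
(* The point x_n has parameter [lam n] on the edge from w r to w (r + 1), r = [side n]. *)
Hypothesis a_gt0 : forall r, (r < l)%N -> (0 < a r)%N.
Hypothesis side_lt : forall n, (n < N)%N -> (side n < l)%N.
Hypothesis side_bounds : forall n, (n < N)%N ->
  (corner a (side n) <= n < corner a (side n).+1)%N.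
Hypothesis lam_bounds : forall n, (n < N)%N -> 0 <= lam n < 1.
Hypothesis lam_eq0 : forall n, (n < N)%N -> (lam n == 0) = (n == corner a (side n)).
Hypothesis lam_mono : forall m n, (m < n)%N -> (n < N)%N -> side m = side n -> lam m < lam n.
Hypothesis xE : forall n, (n < N)%N ->
  x n = (1 - lam n) *: w (side n) + lam n *: w (side n).+1.

Lemma side_mono m n : (m <= n)%N -> (n < N)%N -> (side m <= side n)%N.
Proof.
move=> mn nN; rewrite leqNgt; apply/negP => h; have := corner_mono a h.
by have := side_bounds nN; have := @side_bounds m ltac:(nlia); nlia.
Qed.

Lemma boundary_orient_third p q n : (n < N)%N -> orient p q (x n) =
  (1 - lam n) * orient p q (w (side n)) + lam n * orient p q (w (side n).+1).
Proof. by move=> nN; rewrite xE// orient_conv. Qed.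

Lemma boundary_orient_same m n p : (m < N)%N -> (n < N)%N -> side m = side n ->
  orient (x m) (x n) p = (lam n - lam m) * orient (w (side n)) (w (side n).+1) p.
Proof. by move=> mN nN e; rewrite !xE// e !orientE !mxE; ring. Qed.

Lemma same_sideE m n : (m < N)%N -> same_side l a m n = (n <= corner a (side m).+1)%N.
Proof.
move=> mN; have sb := side_bounds mN; have sl := side_lt mN.
apply/same_sideP/idP => [[r rl /andP[h1 h2]]|h]; last by exists (side m) => //; nlia.
have [h|h] := leqP r (side m); first by have := @corner_mono a r.+1 (side m).+1 h; nlia.
by have := corner_mono a h; nlia.
Qed.

Lemma corner_side n : (n < N)%N -> (corner a l.-1 <= n)%N = (side n == l.-1).
Proof.
move=> nN; have sb := side_bounds nN; have sl := side_lt nN.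
apply/idP/eqP => [h|<-]; last nlia.
have [h'|h'] := ltnP (side n) l.-1; last nlia.
by have := corner_mono a h'; nlia.
Qed.

(** This supplies the hypotheses on orientations made for chains. Each point is expanded between the
    ends of its edge, and the signs come from the vertices, according to which of the three edges
    coincide. *)
Lemma boundary_orient m n p : (m < n)%N -> (n < p)%N -> (p < N)%N ->
  0 <= orient (x m) (x n) (x p) /\
  (orient (x m) (x n) (x p) == 0) =
    same_side l a m p || ((m == 0%N) && (corner a l.-1 <= n)%N).
Proof.
move=> mn np pN; have nN : (n < N)%N by nlia. have mN : (m < N)%N by nlia.
rewrite same_sideE// corner_side//.
have mns : (side m <= side n)%N by apply: side_mono => //; nlia.
have nps : (side n <= side p)%N by apply: side_mono => //; nlia.
have sm := side_bounds mN; have sn := side_bounds nN; have sp := side_bounds pN.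
have slm := side_lt mN; have sln := side_lt nN; have slp := side_lt pN.
have /andP[lm0 lm1] := lam_bounds mN; have /andP[ln0 ln1] := lam_bounds nN.
have /andP[lp0 lp1] := lam_bounds pN.
have m0 : (m == 0%N) = (side m == 0%N) && (lam m == 0).
  rewrite lam_eq0//; apply/eqP/andP => [m0|[/eqP -> /eqP ->]]; last by rewrite /corner big_ord0.
  have s0 : side m = 0%N.
    apply/eqP; rewrite -leqn0 leqNgt; apply/negP => h.
    have := corner_mono a h; rewrite cornerS /corner big_ord0 -/(corner a _).
    by have := @a_gt0 0%N ltac:(nlia); nlia.
  by rewrite s0 /corner big_ord0 m0.
have lm2 : 0 <= 1 - lam m by rewrite subr_ge0 ltW.
have ln2 : 0 <= 1 - lam n by rewrite subr_ge0 ltW.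
have lp2 : 0 <= 1 - lam p by rewrite subr_ge0 ltW.
have pos (t : R) : 0 < t -> 0 <= t /\ (t == 0) = false.
  by move=> t0; rewrite ltW// gt_eqF.
have [emn|nmn] := eqVneq (side m) (side n).
  rewrite boundary_orient_same//; have lmn := lam_mono mn nN emn.
  have d0 : 0 < lam n - lam m by rewrite subr_gt0.
  have [enp|nnp] := eqVneq (side n) (side p).
    have -> : orient (w (side n)) (w (side n).+1) (x p) = 0.
      by rewrite boundary_orient_third// enp orient_ids orient_idr; ring.
    rewrite mulr0 eqxx; split => //; apply/esym/orP; left.
    by rewrite emn enp; nlia.
  have lnp : (side n < side p)%N by rewrite ltn_neqAle nnp.
  have -> : (side n == l.-1) = false by nlia.
  rewrite andbF orbF boundary_orient_third// emn.
  have [e1|n1] := eqVneq (side p) (side n).+1.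
    rewrite e1 orient_idr mulr0 add0r.
    have k1 : 0 < o (side n) (side n).+1 (side n).+2 by apply: convex_orient_gt0; nlia.
    have [l0|l0] := eqVneq (lam p) 0.
      rewrite l0 mul0r mulr0 eqxx; split => //; apply/esym.
      have pe : p == corner a (side n).+1 by rewrite -e1 -lam_eq0// l0 eqxx.
      by rewrite (eqP pe) leqnn.
    have -> : (p <= corner a (side n).+1)%N = false.
      by move: l0; rewrite lam_eq0// e1; move: sp; rewrite e1; nlia.
    apply: pos; rewrite !mulr_gt0//; rewrite lt_neqAle eq_sym l0//.
  have -> : (p <= corner a (side n).+1)%N = false.
    have h2 : ((side n).+1 < side p)%N by nlia.
    have := corner_mono a h2; have := @a_gt0 (side n).+1 ltac:(nlia).
    by rewrite cornerS; nlia.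
  apply: pos; rewrite mulr_gt0// ltr_wpDr//.
    by apply: mulr_ge0 => //; apply: convex_orient_ge0; nlia.
  by apply: mulr_gt0; [rewrite subr_gt0|apply: convex_orient_gt0; nlia].
have lmn : (side m < side n)%N by rewrite ltn_neqAle nmn.
have -> : (p <= corner a (side m).+1)%N = false.
  by have := corner_mono a lmn; nlia.
rewrite /=; have [enp|nnp] := eqVneq (side n) (side p).
  rewrite orient_rot boundary_orient_same// -enp boundary_orient_third//.
  have lnp := lam_mono np pN enp; have d0 : 0 < lam p - lam n by rewrite subr_gt0.
  rewrite -!(orient_rot (w _) (w (side n))) m0.
  (* With m on the first side and n, p on the last, the vertex triple closes up as w l = w 0; the
     orientation then vanishes exactly when x_m is x_0. *)
  have [/andP[/eqP s0 /eqP sl]|hN] := boolP ((side m == 0%N) && (side n == l.-1)).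
    rewrite s0 sl !eqxx andbT /= (_ : l.-1.+1 = l); last nlia.
    have -> : o 0%N l.-1 l = 0 by rewrite w_close orient_ids.
    rewrite mulr0 add0r.
    have [->|ln] := eqVneq (lam m) 0; first by rewrite mul0r mulr0; split; rewrite ?eqxx ?lexx.
    have k1 : 0 < o 1%N l.-1 l by apply: convex_orient_gt0; nlia.
    have lmp : 0 < lam m by rewrite lt_neqAle eq_sym ln.
    by apply: pos; apply: mulr_gt0 => //; apply: mulr_gt0.
  have -> : (side m == 0%N) && (lam m == 0) && (side n == l.-1) = false.
    by apply: contraNF hN => /andP[/andP[-> _] ->].
  apply: pos; rewrite mulr_gt0// ltr_wpDr//.
    by apply: mulr_ge0 => //; apply: convex_orient_ge0; nlia.
  by apply: mulr_gt0; [rewrite subr_gt0|apply: convex_orient_gt0; nlia].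
have lnp : (side n < side p)%N by rewrite ltn_neqAle nnp.
have -> : (side n == l.-1) = false by nlia.
rewrite andbF.
(* On three distinct sides, vertices are replaced by points one at a time; the strict variants keep
   the term with the positive coefficient 1 - lam. *)
have h1 A B : (A <= B)%N -> (B <= side p)%N -> 0 <= orient (w A) (w B) (x p).
  move=> AB Bp; rewrite boundary_orient_third//.
  by apply: addr_ge0; apply: mulr_ge0 => //; apply: convex_orient_ge0; nlia.
have h1' A B : (A < B)%N -> (B < side p)%N -> 0 < orient (w A) (w B) (x p).
  move=> AB Bp; rewrite boundary_orient_third// ltr_wpDr//.
    by apply: mulr_ge0 => //; apply: convex_orient_ge0; nlia.
  by apply: mulr_gt0; [rewrite subr_gt0|apply: convex_orient_gt0; nlia].
have h2 A : (A <= side n)%N -> 0 <= orient (w A) (x n) (x p).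
  move=> An; rewrite -orient_rot boundary_orient_third// !(orient_rot (x p)).
  by apply: addr_ge0; apply: mulr_ge0 => //; apply: h1; nlia.
have h2' A : (A < side n)%N -> 0 < orient (w A) (x n) (x p).
  move=> An; rewrite -orient_rot boundary_orient_third// !(orient_rot (x p)) ltr_wpDr//.
    by apply: mulr_ge0 => //; apply: h1; nlia.
  by apply: mulr_gt0; [rewrite subr_gt0|apply: h1'; nlia].
apply: pos; rewrite orient_rot boundary_orient_third// -!(orient_rot (w _) (x n)) ltr_wpDr//.
  by apply: mulr_ge0 => //; apply: h2; nlia.
by apply: mulr_gt0; [rewrite subr_gt0|apply: h2'; nlia].
Qed.

(** On distinct sides, x_m would lie on the line of the edge of x_n, which is possible only for x_m
    = w 0 and the last side; there lam < 1 excludes the end w l = w 0. *)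
Lemma boundary_injective : {in [pred n | n < N]%N &, injective x}.
Proof.
suff H m n : (m < n)%N -> (n < N)%N -> x m <> x n.
  move=> m n; rewrite !inE => mN nN e; have [h|h|//] := ltngtP m n; exfalso.
    exact: H h nN e.
  exact: H h mN (esym e).
move=> mn nN e; have mN : (m < N)%N by nlia.
have mns : (side m <= side n)%N by apply: side_mono => //; nlia.
have slm := side_lt mN; have sln := side_lt nN.
have /andP[lm0 lm1] := lam_bounds mN; have /andP[ln0 ln1] := lam_bounds nN.
have w1 : 0 < o 1%N l.-1 l by apply: convex_orient_gt0; nlia.
have [emn|nmn] := eqVneq (side m) (side n).
  have d0 : 0 < lam n - lam m by rewrite subr_gt0; apply: lam_mono.
  have H p : orient (w (side n)) (w (side n).+1) p = 0.
    apply/eqP; have := boundary_orient_same p mN nN emn; rewrite e orient_idl.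
    by move=> /esym/eqP; rewrite mulf_eq0 gt_eqF.
  have [sl|sl] := eqVneq (side n) l.-1.
    move: w1; have := H (w 1%N); rewrite sl (_ : l.-1.+1 = l); last nlia.
    by rewrite -orient_rot => ->; rewrite ltxx.
  have : 0 < o (side n) (side n).+1 (side n).+2 by apply: convex_orient_gt0; nlia.
  by rewrite H ltxx.
have lmn : (side m < side n)%N by rewrite ltn_neqAle nmn.
have : orient (w (side n)) (w (side n).+1) (x m) = 0.
  by rewrite e boundary_orient_third// orient_ids orient_idr; ring.
rewrite boundary_orient_third// -!(orient_rot (w _) (w (side n))).
have k0 : 0 <= lam m * o (side m).+1 (side n) (side n).+1.
  by apply: mulr_ge0 => //; apply: convex_orient_ge0; nlia.
have [/andP[/eqP s0 /eqP sl]|hN] := boolP ((side m == 0%N) && (side n == l.-1)).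
  rewrite s0 sl (_ : l.-1.+1 = l); last nlia.
  have -> : o 0%N l.-1 l = 0 by rewrite w_close orient_ids.
  rewrite mulr0 add0r => /eqP; rewrite mulf_eq0 (gt_eqF w1) orbF.
  move=> /eqP lmz; have := congr1 (fun z => orient (w 0%N) (w 1%N) z) e.
  rewrite /= !boundary_orient_third// s0 lmz subr0 mul1r mul0r addr0 orient_ids sl.
  rewrite (_ : l.-1.+1 = l) ?w_close ?orient_ids ?mulr0 ?addr0; last nlia.
  have k : 0 < o 0%N 1%N l.-1 by apply: convex_orient_gt0; nlia.
  by move=> /esym/eqP; rewrite mulf_eq0 (gt_eqF k) orbF subr_eq0 gt_eqF.
have : 0 < (1 - lam m) * o (side m) (side n) (side n).+1.
  by apply: mulr_gt0; [rewrite subr_gt0|apply: convex_orient_gt0; nlia].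
by lra.
Qed.

End ConvexPosition.

Lemma corner_interval (a : nat -> nat) l n : (n < corner a l)%N ->
  exists r, (r < l)%N /\ (corner a r <= n < corner a r.+1)%N.
Proof.
elim: l => [|l IH] h; first by rewrite /corner big_ord0 in h.
have [/IH[r [rl hr]]|nl] := ltnP n (corner a l); first by exists r; split => //; lia.
by exists l; rewrite ltnSn nl h.
Qed.

Lemma corner_interval_uniq (a : nat -> nat) n r r' :
  (corner a r <= n < corner a r.+1)%N -> (corner a r' <= n < corner a r'.+1)%N -> r = r'.
Proof.
move=> h h'; have [lt|lt|//] := ltngtP r r'.
  by have := corner_mono a lt; lia.
by have := corner_mono a lt; lia.
Qed.

(** * A weakly convex polygon as a chain of numbered points *)

Section WeaklyConvex.
Variables (R : realType) (l' : nat).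
Local Notation l := l'.+1.
Variables (a : 'I_l -> nat) (C : config R) (v : 'I_l -> 'rV[R]_2).
Hypothesis hl : (3 <= l)%N.
Hypothesis ha : forall i, (1 <= a i)%N.
Hypothesis wC : weakly_convex C.
Hypothesis vC : ccw_vertices C v.
Hypothesis aC : forall i, edge_weight C (v i) (v (ordS i)) (a i).

Definition vertex (n : nat) : 'rV[R]_2 := v (inord (n %% l)).
Definition weight (r : nat) : nat := a (inord r).

Lemma vertex_ord (i : 'I_l) : vertex i = v i.
Proof. by rewrite /vertex modn_small// inord_val. Qed.

Lemma vertexS (i : 'I_l) : vertex i.+1 = v (ordS i).
Proof.
rewrite /vertex; congr v; apply: val_inj; rewrite /= inordK//.
by rewrite ltn_pmod.
Qed.

Lemma vertex_mod n : vertex (n %% l) = vertex n.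
Proof. by rewrite /vertex modn_mod. Qed.

Lemma vertex_close : vertex l = vertex 0.
Proof. by rewrite /vertex modnn mod0n. Qed.

Lemma vertex_edge i j : (i < l)%N -> (j < l)%N -> j != i -> j != (i.+1 %% l)%N ->
  0 < orient (vertex i) (vertex i.+1) (vertex j).
Proof.
move=> il jl ji ji1; have [_ _ h] := vC.
have := h (Ordinal il) (Ordinal jl); rewrite -vertexS -!vertex_ord /=.
by apply; rewrite -val_eqE.
Qed.

Lemma vertex_edge_ge0 i j : (i < l)%N -> (j < l)%N ->
  0 <= orient (vertex i) (vertex i.+1) (vertex j).
Proof.
move=> il jl; have [->|ji] := eqVneq j i; first by rewrite orient_ids.
have [->|ji1] := eqVneq j (i.+1 %% l)%N; first by rewrite vertex_mod orient_idr.
exact/ltW/vertex_edge.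
Qed.

Lemma vertex_edge_eq0 i j : (i < l)%N -> (j < l)%N ->
  orient (vertex i) (vertex i.+1) (vertex j) = 0 ->
  vertex j \in [fset vertex i; vertex i.+1]%fset.
Proof.
move=> il jl e; rewrite in_fset2.
have [->|ji] := eqVneq j i; first by rewrite eqxx.
have [->|ji1] := eqVneq j (i.+1 %% l)%N; first by rewrite vertex_mod eqxx orbT.
by have := vertex_edge il jl ji ji1; rewrite e ltxx.
Qed.

Lemma config_hull_vertices : {in C, forall p, hull (chain vertex 0 l') p}.
Proof.
have [A CA Aext] := hull_extreme C; have [_ vext _] := vC.
move=> p /CA; apply: hull_mono => e /Aext[_]; rewrite -vext => -[i _ <-].
by rewrite -vertex_ord; apply: chain_in; have := ltn_ord i; lia.
Qed.

Lemma vertex_in_config n : vertex n \in C.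
Proof.
have [A CA Aext] := hull_extreme C; have [_ vext _] := vC.
have subAC : {subset A <= C} by move=> e /Aext[].
apply: (subAC (vertex n)); rewrite /vertex; set i := inord _.
have ext : extreme_point (hull C) (v i) by rewrite -vext; exists i.
by apply: (extreme_in subAC ext); apply: (hull_hull CA); case: ext.
Qed.

(** A point on no edge line is strictly to the left of all edges. This is an open condition that
    keeps it in the hull, so the point would be interior, against weak convexity. *)
Lemma config_side p : p \in C ->
  exists2 r, (r < l)%N & hull [fset vertex r; vertex r.+1]%fset p.
Proof.
move=> pC; have ph := config_hull_vertices pC.
have ge0 r : (r < l)%N -> {in chain vertex 0 l', forall z, 0 <= orient (vertex r) (vertex r.+1) z}.
  by move=> rl _ /chainP[j hj ->]; apply: vertex_edge_ge0 => //; lia.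
have [[r rl e]|none] := pselect (exists2 r, (r < l)%N & orient (vertex r) (vertex r.+1) p = 0).
  exists r => //; apply: (@hull_mono _ (chain vertex 0 l' `&` [fset vertex r; vertex r.+1])%fset).
    by move=> z; rewrite in_fsetI => /andP[].
  apply: (hull_face (ge0 r rl) _ ph e) => _ /chainP[j hj ->].
  by apply: vertex_edge_eq0 => //; lia.
have gt0 r : (r < l)%N -> 0 < orient (vertex r) (vertex r.+1) p.
  move=> rl; rewrite lt_neqAle (hull_ge0 (ge0 r rl) ph) andbT eq_sym.
  by apply/eqP => e; apply: none; exists r.
have [_ []] := wC pC.
have near_all : \forall y \near p, forall i : 'I_l, 0 < orient (vertex i) (vertex i.+1) y.
  apply: (@filter_forall _ 'I_l (fun i y => is_true (0 < orient (vertex i) (vertex i.+1) y))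
    (nbhs p) (nbhs_filter p)) => i.
  exact: (orient_near (gt0 i (ltn_ord i))).
apply: filterS near_all => y hy.
have : hull (chain vertex 0 l') y.
  by apply: (hull_vertices hl vertex_edge vertex_close) => r rl; apply: (hy (Ordinal rl)).
by apply: hull_mono => _ /chainP[n _ ->]; apply: vertex_in_config.
Qed.

Definition side_points r : {fset 'rV[R]_2} :=
  [fset z in C | `[< segment (vertex r) (vertex r.+1) z >]]%fset.

Lemma side_pointsP r z : reflect (z \in C /\ hull [fset vertex r; vertex r.+1]%fset z)
  (z \in side_points r).
Proof.
rewrite !inE /=; apply: (iffP andP) => -[zC h]; split => //; first exact/asboolP.
exact/asboolP.
Qed.

Lemma vertex_neq r : (r < l)%N -> vertex r != vertex r.+1.
Proof.
move=> rl; have [vi _ _] := vC; rewrite -[r]/(val (Ordinal rl)) vertex_ord vertexS.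
apply/eqP => /vi /(congr1 val) /=; have [->|rn] := eqVneq r l'; first by rewrite modnn; lia.
by rewrite modn_small; lia.
Qed.

Lemma side_enum r : (r < l)%N -> exists lam : nat -> R, [/\ lam 0%N = 0, lam (weight r) = 1,
  forall c d, (c < d)%N -> (d <= weight r)%N -> lam c < lam d &
  forall z, z \in side_points r <->
    exists2 c, (c <= weight r)%N & z = (1 - lam c) *: vertex r + lam c *: vertex r.+1].
Proof.
move=> rl; apply: segment_enum (vertex_neq rl) _ _ _ _.
- by move=> z /side_pointsP[].
- apply/side_pointsP; split; first exact: vertex_in_config.
  by apply: hull_in; rewrite !inE eqxx.
- apply/side_pointsP; split; first exact: vertex_in_config.
  by apply: hull_in; rewrite !inE eqxx orbT.
- have := aC (Ordinal rl); rewrite /edge_weight -vertexS -vertex_ord /= -/(side_points r) => ->.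
  by congr (a _).+1; apply: val_inj; rewrite /= inordK.
Qed.

Lemma weight_gt0 r : (0 < weight r)%N. Proof. exact: ha. Qed.

Lemma weakly_convex_triangulation_poly :
  triangulation_poly C = catalan_pairing (\prod_(i < l) complete_edge_poly (a i)).
Proof.
pose N := corner weight l; pose A := corner weight l'; pose S := same_side l weight.
have [lm Hlm] : {lm : nat -> nat -> R & forall r, (r < l)%N ->
    [/\ lm r 0%N = 0, lm r (weight r) = 1,
    forall c d, (c < d)%N -> (d <= weight r)%N -> lm r c < lm r d &
    forall z, z \in side_points r <->
    exists2 c, (c <= weight r)%N & z = (1 - lm r c) *: vertex r + lm r c *: vertex r.+1]}.
  apply: (@choice _ _ (fun r (lam : nat -> R) => (r < l)%N -> [/\ lam 0%N = 0, lam (weight r) = 1,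
    forall c d, (c < d)%N -> (d <= weight r)%N -> lam c < lam d &
    forall z, z \in side_points r <->
    exists2 c, (c <= weight r)%N & z = (1 - lam c) *: vertex r + lam c *: vertex r.+1])) => r.
  have [/side_enum[lam hlam]|_] := ltnP r l; first by exists lam.
  by exists (fun=> 0).
have [side Hside] : {side : nat -> nat & forall n, (n < N)%N ->
    (side n < l)%N /\ (corner weight (side n) <= n < corner weight (side n).+1)%N}.
  apply: (@choice _ _ (fun n r => (n < N)%N ->
    (r < l)%N /\ (corner weight r <= n < corner weight r.+1)%N)) => n.
  have [/corner_interval[r hr]|_] := ltnP n N; first by exists r.
  by exists 0%N.
have side_lt n : (n < N)%N -> (side n < l)%N by case/Hside.
have side_bounds n : (n < N)%N -> (corner weight (side n) <= n < corner weight (side n).+1)%N.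
  by case/Hside.
have side_uniq n r : (r < l)%N -> (corner weight r <= n < corner weight r.+1)%N ->
    (n < N)%N /\ side n = r.
  move=> rl hr; have nN : (n < N)%N by have := corner_mono weight rl; rewrite -/N; lia.
  by split => //; apply: corner_interval_uniq (side_bounds n nN) hr.
pose lam n := lm (side n) (n - corner weight (side n))%N.
pose x n := (1 - lam n) *: vertex (side n) + lam n *: vertex (side n).+1.
have off n : (n < N)%N -> (n - corner weight (side n) < weight (side n))%N.
  by move=> /side_bounds; rewrite cornerS; lia.
have lam_bounds n : (n < N)%N -> 0 <= lam n < 1.
  move=> nN; have [h0 h1 hm _] := Hlm _ (side_lt n nN); have on := off n nN.
  rewrite /lam -h1 hm// andbT.
  case: (_ - _)%N on => [|c] on; first by rewrite h0.
  by rewrite -h0 ltW// hm// ltnW.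
have lam_eq0 n : (n < N)%N -> (lam n == 0) = (n == corner weight (side n)).
  move=> nN; have [h0 h1 hm _] := Hlm _ (side_lt n nN); have on := off n nN.
  have sb := side_bounds n nN; rewrite /lam.
  case e : (n - corner weight (side n))%N on => [|c] on.
    by rewrite h0 eqxx; apply/esym/eqP; lia.
  by rewrite -h0 gt_eqF ?hm//; [apply/esym/eqP; lia|exact: ltnW].
have lam_mono m n : (m < n)%N -> (n < N)%N -> side m = side n -> lam m < lam n.
  move=> mn nN e; have [_ _ hm _] := Hlm _ (side_lt n nN); have on := off n nN.
  have := side_bounds m (ltn_trans mn nN); have := side_bounds n nN.
  by rewrite /lam e => h1 h2; apply: hm; lia.
have xE n : (n < N)%N -> x n = (1 - lam n) *: vertex (side n) + lam n *: vertex (side n).+1.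
  by [].
have aP r : (r < l)%N -> (0 < weight r)%N by move=> _; exact: weight_gt0.
have ox := boundary_orient hl vertex_edge vertex_close aP side_lt side_bounds lam_bounds
  lam_eq0 lam_mono xE.
have xinj := boundary_injective hl vertex_edge vertex_close side_lt side_bounds lam_bounds
  lam_mono xE.
have ox_ge0 m n p : (m < n)%N -> (n < p)%N -> (p < N)%N -> 0 <= orient (x m) (x n) (x p).
  by move=> mn np pN; have [] := ox m n p mn np pN.
have ox_eq0 m n p : (m < n)%N -> (n < p)%N -> (p < N)%N ->
    (orient (x m) (x n) (x p) == 0) = S m p || ((m == 0%N) && (A <= n)%N).
  by move=> mn np pN; have [] := ox m n p mn np pN.
have x_corner r : (r < l)%N -> (corner weight r < N)%N /\ x (corner weight r) = vertex r.
  move=> rl; have [|nN e] := side_uniq (corner weight r) r rl.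
    by rewrite cornerS; have := weight_gt0 r; lia.
  split => //; rewrite /x /lam e subnn; have [-> _ _ _] := Hlm r rl.
  by rewrite subr0 scale1r scale0r addr0.
have N0 : (0 < N)%N by have [h _] := x_corner 0%N isT; lia.
have CE : C = chain x 0 N.-1.
  apply/fsetP => p; apply/idP/chainP => [pC|[n hn ->]].
    have [r rl hr] := config_side pC; have [h0 h1 _ hz] := Hlm r rl.
    have [c cr pE] := (hz p).1 (introT (side_pointsP r p) (conj pC hr)).
    (* The far end of a side is numbered as the first point of the next side, or as x_0 after the
       last one. *)
    have [cw|cw] := eqVneq c (weight r).
      have pv : p = vertex r.+1 by rewrite pE cw h1 subrr scale0r add0r scale1r.
      have [rl'|rl'] := eqVneq r l'.
        have [h e] := x_corner 0%N isT; exists (corner weight 0); first by lia.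
        by rewrite e pv rl' vertex_close.
      have [h e] := x_corner r.+1 ltac:(lia); exists (corner weight r.+1); first by lia.
      by rewrite e.
    have [|nN e] := side_uniq (corner weight r + c)%N r rl; first by rewrite cornerS; lia.
    exists (corner weight r + c)%N; first by lia.
    by rewrite /x /lam e addKn.
  have nN : (n < N)%N by lia.
  have [_ _ _ hz] := Hlm _ (side_lt n nN).
  have /side_pointsP[] // : x n \in side_points (side n).
  by apply/(hz (x n)).2; exists (n - corner weight (side n))%N; rewrite // ltnW ?off.
have S_sub m n p q : (m <= n)%N -> (p <= q)%N -> S m q -> S n p.
  move=> mn pq /same_sideP[r rl h]; apply/same_sideP; exists r => //; lia.
have S_succ n : (n.+1 < N)%N -> S n n.+1.
  move=> nN; apply/same_sideP; exists (side n); first exact/side_lt/ltnW.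
  by have := side_bounds n (ltnW nN); lia.
have NA : N = (A + weight l')%N by rewrite /N cornerS.
have wl := weight_gt0 l'.
have S_last q : (q < N)%N -> S q N = (A <= q)%N.
  move=> qN; apply/same_sideP/idP => [[r rl /andP[h1 h2]]|h].
    have [rE|rl'] := eqVneq r l'; first by rewrite rE in h1.
    have rl2 : (r.+1 <= l')%N by lia.
    by have := corner_mono weight rl2; rewrite -/A; lia.
  by exists l'; rewrite // -/A -/N h leqnn.
(* As l >= 3, two sides at least precede the last one, so x_0 and x_A are on no common side among
   them. *)
have A0 : (weight 0 + weight 1 <= A)%N.
  have h2 : (2 <= l')%N by lia.
  by have := corner_mono weight h2; rewrite /corner !big_ord_recl big_ord0 /= addn0.
have w0 := weight_gt0 0; have w1 := weight_gt0 1.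
have c0 : corner weight 0 = 0%N by rewrite /corner big_ord0.
have S_first : ~~ S 0 A.
  apply/negP => /same_sideP[r rl /andP[h1 h2]].
  have r0 : r = 0%N.
    apply/eqP; rewrite -leqn0 leqNgt; apply/negP => r0.
    by have := corner_mono weight r0; rewrite cornerS c0; lia.
  by move: h2; rewrite r0 cornerS c0; lia.
have AN : (0 < A < N)%N by lia.
(* The whole configuration is the polygon closed by its last side, hence B = A. *)
have P : polygon N A S 0 N.-1 A by split => //; try lia; right.
rewrite CE (polygon_triangulation_poly S_succ S_sub xinj ox_ge0 ox_eq0 P) prednK//.
rewrite (chain_poly_total S_sub AN S_last S_first); first last.
- move=> i j ij hA nS; apply: (chain_poly_nS S_succ S_sub xinj ox_ge0 ox_eq0).
  by split => //; try lia; left; split => //; lia.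
- by move=> i j ij Sij; apply: (chain_poly_S xinj).
rewrite -(pairing_path_poly S N0) (path_poly_corner weight (leqnn l)); congr catalan_pairing.
apply: eq_bigr => i _; rewrite /weight inord_val /edge_poly.
by have := ha i; case: (a i).
Qed.

End WeaklyConvex.

Theorem theorem3 (R : realType) (l : nat) (a : 'I_l -> nat) (C : config R)
    (hl : (3 <= l)%N) (ha : forall i, (1 <= a i)%N) (hC : is_P a C) :
  triangulation_poly C = catalan_pairing (\prod_(i < l) complete_edge_poly (a i)).
Proof.
case: l a hl ha hC => // l' a hl ha [wC [v [vC aC]]].
exact: weakly_convex_triangulation_poly hl ha wC vC aC.
Qed.
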